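(* Let $\mathsf{N}_n$ be a uniformly random simplex tree-child network with $n$ taxa. There exists an infinite deterministic network $\hat{\mathsf{N}}$, namely the network with root $o$ constructed in the context, such that $\mathsf{N}_n\xrightarrow{d}\hat{\mathsf{N}}$ in the local weak sense at the root. That is, for every fixed integer $R\ge0$, with $o_n$ the root of $\mathsf{N}_n$, $$\mathbb{P}\bigl(U_R(\mathsf{N}_n,o_n)\cong U_R(\hat{\mathsf{N}},o)\bigr)\longrightarrow1\qquad(n\to\infty).$$
   Context: A simplex tree-child network on a finite set $X$ is a finite directed acyclic graph $N=(V,E)$ with a root $o$ and with leaves bijectively labelled by $X$, such that: the root has (indegree, outdegree) $=(0,1)$; every vertex is reachable from $o$ by a directed path; every leaf has degree $(1,0)$; every vertex that is neither the root nor a leaf is either a tree vertex, of degree $(1,2)$, or a reticulation vertex, of degree $(2,1)$; (tree-child) every non-leaf vertex has at least one child that is a tree vertex or a leaf; (one-component) the unique child of every reticulation vertex is a leaf. Networks are considered up to isomorphism preserving leaf labels. $\mathsf{N}_n$ is uniform on the finite set of simplex tree-child networks with leaf label set $[n]$. Local neighbourhoods: for a directed graph $N$ and $v\in V(N)$, $U_R(N,v)$ is the subgraph induced by the vertices at undirected graph distance at most $R$ from $v$, rooted at $v$. Each vertex carries a mark giving its type in $N$ (root, tree vertex, reticulation, or leaf); leaf labels are ignored. $\cong$ denotes isomorphism of rooted directed marked graphs, i.e. a bijection of vertex sets preserving root, marks, edges and edge orientations. Local weak convergence $(N_n,v_n)\xrightarrow{d}(N,v)$ means $\mathbb{P}(U_R(N_n,v_n)\cong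 G)\to\mathbb{P}(U_R(N,v)\cong G)$ for every fixed $R\ge0$ and every finite rooted directed marked graph $G$. Construction. A bi-infinite spine is a bi-infinite directed path $\cdots\to x_{-1}\to x_0\to x_1\to\cdots$ of tree vertices. To decorate a tree vertex $x$ means: give $x$ a new reticulation child $\rho(x)$; give $\rho(x)$ a new leaf child $\ell(x)$; and give $\rho(x)$ a second parent $w(x)$, which is a tree vertex on a new bi-infinite spine, all of whose vertices other than $w(x)$ are in turn decorated, recursively (the reticulation child of $w(x)$ is $\rho(x)$). All spines and vertices introduced at every level are pairwise distinct. The network $\hat{\mathsf{N}}$ consists of a root $o$ followed by a one-ended directed path $o\to v_1\to v_2\to\cdots$ of tree vertices, in which every $v_t$, $t\ge1$, is decorated. *)

(* Defs.v *)
From HB Require Import structures.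
From mathcomp Require Import all_boot all_order all_algebra.
From mathcomp Require Import all_classical all_reals all_analysis.
From mathcomp Require Import zify.

Set Implicit Arguments.
Unset Strict Implicit.
Unset Printing Implicit Defensive.

Import Order.TTheory GRing.Theory Num.Theory.
Import numFieldNormedType.Exports.

Local Open Scope classical_set_scope.
Local Open Scope nat_scope.

Inductive vtype := RootV | TreeV | RetV | LeafV.

(* A directed graph, marked by vertex types, with a distinguished vertex: this
   is the pair (N, v) of local convergence. The vertex [base] need not carry
   the mark [RootV]. *)
Record mgraph := MGraph {
  vert : Type;
  edge : vert -> vert -> Prop;
  mark : vert -> vtype;
  base : vert }.

Definition mgraph_iso (G H : mgraph) : Prop :=
  exists f : vert G -> vert H,
    [/\ bijective f,
        f (base G) = base H,
        forall v, mark (f v) = mark v &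
        forall u v, edge u v <-> edge (f u) (f v)].

Definition adjacent (G : mgraph) (u v : vert G) : Prop :=
  edge u v \/ edge v u.

Definition dist_le (G : mgraph) (r : nat) (u v : vert G) : Prop :=
  exists p : seq (vert G),
    [/\ path (fun x y => `[< adjacent x y >]) u p, last u p = v & size p <= r].

Lemma dist_le_base (G : mgraph) (r : nat) :
  base G \in [set v | dist_le r (base G) v].
Proof. by rewrite inE /=; exists [::]. Qed.

(* U_r(N, v): marks are inherited, so they record the types in N. *)
Definition ball_graph (r : nat) (G : mgraph) : mgraph :=
  @MGraph (set_type [set v | dist_le r (base G) v])
    (fun u v => edge (val u) (val v))
    (fun v => mark (val v))
    (exist _ (base G) (dist_le_base G r)).

Record network (X V : finType) := Network {
  net_edges : {set V * V};
  net_root : V;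
  net_label : {ffun X -> V} }.

Section NetworkFinite.
Variables X V : finType.

Definition network_code (N : network X V) :=
  (net_edges N, net_root N, net_label N).
Definition network_decode (c : {set V * V} * V * {ffun X -> V}) :=
  Network c.1.1 c.1.2 c.2.
Lemma network_codeK : cancel network_code network_decode.
Proof. by case. Qed.

HB.instance Definition _ := Finite.copy (network X V) (can_type network_codeK).

End NetworkFinite.

Section Networks.
Variables X V : finType.
Implicit Types (N : network X V) (u v w : V).

Definition net_edge N : rel V := fun u v => (u, v) \in net_edges N.

(* (indegree, outdegree) *)
Definition degrees N v : nat * nat :=
  (#|[pred u | net_edge N u v]|, #|[pred w | net_edge N v w]|).

Definition is_leaf N v := degrees N v == (1, 0).
Definition is_tree N v := degrees N v == (1, 2).
Definition is_ret N v := degrees N v == (2, 1).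

Definition acyclic N : Prop := forall v p, ~~ cycle (net_edge N) (v :: p).

Definition tree_child N : Prop :=
  forall v, ~~ is_leaf N v ->
    exists2 c, net_edge N v c & is_tree N c || is_leaf N c.

Definition one_component N : Prop :=
  forall v c, is_ret N v -> net_edge N v c -> is_leaf N c.

Definition simplex_tree_child N : Prop :=
  [/\ acyclic N,
      degrees N (net_root N) = (0, 1) /\
        (forall v, connect (net_edge N) (net_root N) v),
      injective (net_label N) /\
        (forall v, is_leaf N v <-> exists x, net_label N x = v),
      forall v, v != net_root N -> [|| is_leaf N v, is_tree N v | is_ret N v] &
      tree_child N /\ one_component N].

Definition net_mark N v : vtype :=
  if v == net_root N then RootV
  else if is_leaf N v then LeafV
  else if is_ret N v then RetV
  else TreeV.

Definition mgraph_of N : mgraph :=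
  @MGraph V (net_edge N) (net_mark N) (net_root N).

Lemma simplex_tree_child_card N :
  simplex_tree_child N -> #|V| <= 4 * #|X|.
Proof.
case=> _ [oP _] [linj lP] vP [_ cP].
pose e (u v : V) : nat := net_edge N u v.
pose isr v : nat := v == net_root N.
pose L v : nat := is_leaf N v.
pose T v : nat := is_tree N v.
pose K v : nat := is_ret N v.
have inE_ v : \sum_u e u v = (degrees N v).1.
  by rewrite /= -sum1_card [RHS]big_mkcond /=; apply: eq_bigr => u _;
    rewrite /e inE; case: net_edge.
have outE_ v : \sum_w e v w = (degrees N v).2.
  by rewrite /= -sum1_card [RHS]big_mkcond /=; apply: eq_bigr => u _;
    rewrite /e inE; case: net_edge.
have vE v : [/\ 1 = isr v + L v + T v + K v,
    (degrees N v).1 = L v + T v + 2 * K v &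
    (degrees N v).2 = isr v + 2 * T v + K v].
  rewrite /isr /L /T /K /is_leaf /is_tree /is_ret.
  have [->|vo] := eqVneq v (net_root N); first by rewrite oP.
  by have /or3P[] := vP _ vo => /eqP->.
have sumV : #|V| = \sum_v isr v + \sum_v L v + \sum_v T v + \sum_v K v.
  rewrite -sum1_card -!big_split /=; apply: eq_bigr => v _.
  by have [] := vE v.
have sum_root : \sum_v isr v = 1.
  rewrite (bigD1 (net_root N)) //= /isr eqxx big1 // => v /negPf.
  by move=> ->.
have sum_leaf : \sum_v L v = #|X|.
  rewrite -(card_codom linj) -sum1_card [RHS]big_mkcond; apply: eq_bigr => v _.
  have -> : v \in codom (net_label N) = is_leaf N v.
    apply/idP/idP => [/codomP[x vx]|/lP[x <-]]; last exact: codom_f.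
    by apply/lP; exists x.
  by rewrite /L; case: is_leaf.
have sum_deg : \sum_v L v + \sum_v T v + 2 * \sum_v K v =
    \sum_v isr v + 2 * \sum_v T v + \sum_v K v.
  rewrite !big_distrr -!big_split /=.
  transitivity (\sum_v \sum_u e u v).
    by apply: eq_bigr => v _; rewrite inE_; have [_ ->] := vE v.
  rewrite exchange_big; apply: eq_bigr => v _.
  by rewrite outE_; have [_ _ ->] := vE v.
have KL : \sum_v K v <= \sum_v L v.
  have -> : \sum_v K v = \sum_v \sum_w K v * e v w.
    apply: eq_bigr => v _; rewrite -big_distrr outE_ /K /is_ret.
    by case: eqP => // ->.
  have -> : \sum_v L v = \sum_v \sum_w L w * e v w.
    rewrite exchange_big; apply: eq_bigr => v _.
    by rewrite -big_distrr inE_ /L /is_leaf; case: eqP => // ->.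
  apply: leq_sum => v _; apply: leq_sum => w _; rewrite /K /L /e.
  have [rv|//] := boolP (is_ret N v).
  have [vw|] := boolP (net_edge N v w); last by rewrite muln0.
  by rewrite (cP _ _ rv vw).
by move: sumV sum_root sum_leaf sum_deg KL; lia.
Qed.

End Networks.

Definition network_iso (X V W : finType) (N : network X V) (M : network X W)
    : Prop :=
  exists f : V -> W,
    [/\ bijective f,
        f (net_root N) = net_root M,
        forall u v, net_edge N u v = net_edge M (f u) (f v) &
        forall x, f (net_label N x) = net_label M x].

(* By [simplex_tree_child_card], every simplex tree-child network on [n] is
   isomorphic to one whose vertex set is 'I_m with m <= 4 n. *)
Definition bnetwork (n : nat) : finType :=
  {m : 'I_(4 * n).+1 & network 'I_n 'I_m}.

(* Simplex tree-child networks on [n], up to isomorphism. *)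
Definition networks (n : nat) : {set {set bnetwork n}} :=
  equivalence_partition (fun N M : bnetwork n => `[< network_iso (tagged N) (tagged M) >])
    [set N : bnetwork n | `[< simplex_tree_child (tagged N) >]]%SET.

(* Probability, for N_n uniform on [networks n], that the rooted graph
   (N_n, o_n) has the isomorphism-invariant property A. *)
Definition prob_net (R : realType) (n : nat) (A : mgraph -> Prop) : R :=
  (#|[set B in networks n | [exists N in B, `[< A (mgraph_of (tagged N)) >]]]%SET|%:R
    / #|networks n|%:R)%R.

(* Decorated tree vertices of the limit. [Before x k] and [After x k] are the
   vertices at positions -(k+1) and k+1 of the bi-infinite spine created by
   decorating x, whose position 0 is w(x). *)
Inductive dec_vertex :=
  | RootSpine of nat                (* [RootSpine t] is v_(t+1) *)
  | Before of dec_vertex & nat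
  | After of dec_vertex & nat.

Inductive hat_vertex :=
  | HRoot
  | HDec of dec_vertex              (* x itself *)
  | HRet of dec_vertex              (* rho(x) *)
  | HLeaf of dec_vertex             (* ell(x) *)
  | HW of dec_vertex.               (* w(x) *)

Definition spine (x : dec_vertex) (i : int) : hat_vertex :=
  match i with
  | Posz 0 => HW x
  | Posz k.+1 => HDec (After x k)
  | Negz k => HDec (Before x k)
  end.

Inductive hat_edge : hat_vertex -> hat_vertex -> Prop :=
  | hat_edge_root : hat_edge HRoot (HDec (RootSpine 0))
  | hat_edge_root_spine t :
      hat_edge (HDec (RootSpine t)) (HDec (RootSpine t.+1))
  | hat_edge_spine x (i : int) : hat_edge (spine x i) (spine x (i + 1)%R)
  | hat_edge_dec_ret x : hat_edge (HDec x) (HRet x)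
  | hat_edge_w_ret x : hat_edge (HW x) (HRet x)
  | hat_edge_ret_leaf x : hat_edge (HRet x) (HLeaf x).

Definition hat_mark (v : hat_vertex) : vtype :=
  match v with
  | HRoot => RootV
  | HDec _ | HW _ => TreeV
  | HRet _ => RetV
  | HLeaf _ => LeafV
  end.

Definition hatN : mgraph := MGraph hat_edge hat_mark HRoot.

(* Local weak convergence at the root to the deterministic limit (H, base H),
   for which P(U_r(H) ~ G) is an indicator. *)
Definition local_weak_cvg (R : realType) (H : mgraph) : Prop :=
  forall (r : nat) (G : mgraph), finite_set [set: vert G] ->
    (fun n => prob_net R n (fun N => mgraph_iso (ball_graph r N) G)) @ \oo -->
      ((`[< mgraph_iso (ball_graph r H) G >])%:R : R)%R.

(* Main.v *)
Require Import Defs.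
From HB Require Import structures.
From mathcomp Require Import all_boot all_order all_algebra perm.
From mathcomp Require Import all_classical all_reals all_analysis.
From mathcomp Require Import zify.
Import Order.TTheory GRing.Theory Num.Theory.
Import numFieldNormedType.Exports.

(* Cutting out the reticulations of a simplex tree-child network on [n] leaves a
   rooted tree in which every label of a reticulation leaf marks two unary
   vertices. Read the tree path by path, as in the Foata-Fuchs bijection: from
   the root to the first leaf, then from the part already read to the second
   leaf, and so on. This gives a word of length 2n - 2 in which every letter (a
   marking label or a branching vertex) occurs exactly twice, and consecutive
   letters are parent and child unless a path ends in between. So
   networks correspond to pairings of 2n - 2 positions in which some pairs are
   injectively labelled by [n]. Labelling one more pair is a double counting
   which shows that the number U of unlabelled positions satisfies
   E[U^2] <= 4n, so almost all positions are labelled. Permuting positions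
   preserves the uniform law, so the partner of a given position is nearly
   uniform: exploring boundedly many windows, each around the partner of a
   position already seen, one finds with probability tending to 1 that the
   windows are disjoint and contain only labelled positions, and then the ball
   around the root is that of the limit. *)

Set Implicit Arguments.
Unset Strict Implicit.
Unset Printing Implicit Defensive.

Local Open Scope nat_scope.

(** * Codes *)

(** No asymptotic enumeration enters. Every estimate injects pairs (code, choice) into pairs (new
    code, mark) and compares the numbers of choices and of marks, so the number of codes is never
    computed. The length of the word: n leaves and k reticulations force n - 1 + k tree vertices.
    Each reticulation has two of them as parents and no tree vertex has two reticulation children,
    so n - 1 - k tree vertices remain without one, and there are k + (n - 1 - k) letters, each used
    twice. Labelled positions are the good ones: such a position is a vertex of its own and no path
    ends there, so a labelled window spells a directed path of tree vertices. The pairing and the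
    labelling are not independent; this is why the exploration exchanges two labelled positions
    only, which leaves the set of labelled positions unchanged. *)

(* A code for a network with [N.+1] leaves: a pairing of [N.*2] positions and a
   labelling of some of the pairs, distinct pairs having distinct labels. The
   labelled pairs are the two parents of a reticulation whose leaf has that
   label; the unlabelled pairs are the vertices with no reticulation child. *)
Notation pcode N := {ffun 'I_N.*2 -> 'I_N.*2 * option 'I_N.+1}.

Section Codes.
Variable N : nat.
Implicit Types (c : pcode N) (p q z : 'I_N.*2) (i : 'I_N.+1).

Definition mate c p := (c p).1.
Definition lbl c p := (c p).2.

Definition is_code c :=
  [&& [forall p, mate c p != p], [forall p, mate c (mate c p) == p],
      [forall p, lbl c (mate c p) == lbl c p] &
      [forall p, forall q, (lbl c p != None) && (lbl c p == lbl c q) ==>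
         (q == p) || (q == mate c p)]].

Definition codes : {set pcode N} := [set c | is_code c]%SET.

Lemma codesP c :
  reflect [/\ forall p, mate c p != p, forall p, mate c (mate c p) = p,
              forall p, lbl c (mate c p) = lbl c p &
              forall p q, lbl c p -> lbl c p = lbl c q -> q = p \/ q = mate c p]
          (c \in codes).
Proof.
rewrite inE; apply: (iffP and4P) => -[h1 h2 h3 h4].
  split=> [p|p|p|p q lp pq].
  - exact: (forallP h1).
  - exact/eqP/(forallP h2).
  - exact/eqP/(forallP h3).
  have /forallP/(_ q)/implyP := forallP h4 p.
  have np : lbl c p != None by case: (lbl c p) lp.
  rewrite np pq eqxx => /(_ isT)/orP[/eqP|/eqP]; by [left|right].
split; [exact/forallP| | |].
- by apply/forallP => p; rewrite h2.
- by apply/forallP => p; rewrite h3.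
apply/forallP => p; apply/forallP => q; apply/implyP => /andP[np /eqP pq].
have lp : lbl c p by case: (lbl c p) np.
by have [->|->] := h4 p q lp pq; rewrite eqxx ?orbT.
Qed.

Definition unl c : nat := #|[set p | lbl c p == None]%SET|.
Definition unused c := [set i | [forall p, lbl c p != Some i]]%SET.

Lemma unusedPn i c : reflect (exists p, lbl c p = Some i) (i \notin unused c).
Proof.
rewrite inE negb_forall; apply: (iffP existsP) => -[p].
  by rewrite negbK => /eqP; exists p.
by exists p; rewrite negbK; apply/eqP.
Qed.

(** Each used label sits on exactly one pair, so the [N.*2] positions are the [unl c] unlabelled
    ones and two for each of the used labels among [N.+1]. *)
Lemma card_unused c : c \in codes -> 2 * #|unused c| = unl c + 2.
Proof.
move=> /codesP[h1 h2 h3 h4].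
have fib i : #|[set p | lbl c p == Some i]%SET| = 2 * (i \notin unused c).
  case: unusedPn => [[p lp]|noi]; last first.
    apply/eqP; rewrite cards_eq0; apply/eqP/setP => p; rewrite !inE.
    by apply/negP => /eqP lp; apply: noi; exists p.
  suff -> : [set p | lbl c p == Some i]%SET = [set p; mate c p]%SET.
    by rewrite cards2 eq_sym h1.
  apply/setP => q; rewrite !inE; apply/eqP/orP.
    move=> lq; have [|//|->|->] := h4 p q; rewrite ?lp ?lq ?eqxx //; by [left|right].
  by case=> /eqP->; rewrite ?h3.
have tot : N.*2 = unl c + \sum_i #|[set p | lbl c p == Some i]%SET|.
  rewrite -[LHS]card_ord -sum1_card (bigID (fun p => lbl c p == None)) /=.
  congr (_ + _).
    by rewrite /unl -sum1_card; apply: eq_bigl => p; rewrite !inE.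
  under [RHS]eq_bigr => i _ do rewrite -sum1_card big_mkcond /=.
  rewrite exchange_big /= big_mkcond; apply: eq_bigr => p _.
  case pl: (lbl c p) => [i|] /=.
    rewrite (bigD1 i) //= inE pl eqxx big1 ?addn0 // => j ji.
    by rewrite inE pl (inj_eq Some_inj) eq_sym (negPf ji).
  by rewrite big1 // => j _; rewrite inE pl.
rewrite (eq_bigr _ (fun i _ => fib i)) -big_distrr /= in tot.
have e2 : \sum_i (i \notin unused c : nat) + #|unused c| = N.+1.
  rewrite -[RHS]card_ord -[RHS]sum1_card -sum1_card [X in _ + X]big_mkcond.
  by rewrite -big_split; apply: eq_bigr => i _; case: (i \in unused c).
move: tot e2; set a := #|_|; set b := \sum_i _; lia.
Qed.

(** Conjugation of the pairing and transport of the labels by a transposition. For fixed [q] and [z]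
    it is an involution on codes, so a switching can be undone once both are known. *)
Definition swap c q z : pcode N :=
  [ffun p => (tperm q z (mate c (tperm q z p)), lbl c (tperm q z p))].

Lemma mate_swap c q z p : mate (swap c q z) p = tperm q z (mate c (tperm q z p)).
Proof. by rewrite /mate /swap ffunE. Qed.

Lemma lbl_swap c q z p : lbl (swap c q z) p = lbl c (tperm q z p).
Proof. by rewrite /lbl /swap ffunE. Qed.

Lemma swapK c q z : swap (swap c q z) q z = c.
Proof.
apply/ffunP => p; rewrite {1}/swap ffunE mate_swap lbl_swap !tpermK.
by rewrite /mate /lbl -surjective_pairing.
Qed.

Lemma swap_codes c q z : c \in codes -> swap c q z \in codes.
Proof.
move=> /codesP[h1 h2 h3 h4]; apply/codesP; split=> [p|p|p|p p'].
- rewrite mate_swap; apply: contra (h1 (tperm q z p)) => /eqP e.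
  by rewrite -{2}e tpermK.
- by rewrite !mate_swap tpermK h2 tpermK.
- by rewrite !lbl_swap mate_swap tpermK h3.
rewrite !lbl_swap mate_swap => lp /(h4 _ _ lp)[e|e].
  by left; apply: (can_inj (tpermK q z)).
by right; rewrite -e tpermK.
Qed.

Definition set_label c p i : pcode N :=
  [ffun q => (mate c q, if (q == p) || (q == mate c p) then Some i else lbl c q)].

Lemma set_label_codes c p i :
  c \in codes -> lbl c p = None -> i \in unused c -> set_label c p i \in codes.
Proof.
move=> /codesP[h1 h2 h3 h4] lp; rewrite inE => /forallP iP.
have eqm q q' : (mate c q == q') = (q == mate c q').
  by apply/eqP/eqP => [<-|->].
have mE q : mate (set_label c p i) q = mate c q by rewrite /mate ffunE.
have lE q : lbl (set_label c p i) q
  = if (q == p) || (q == mate c p) then Some i else lbl c q.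
  by rewrite {1}/lbl ffunE.
apply/codesP; split=> [q|q|q|q q']; rewrite ?mE ?lE //.
  by rewrite h3 eqm (inj_eq (can_inj h2)) orbC.
case: ifP => qp; case: ifP => qp' //.
- case/orP: qp qp' => /eqP-> /orP[]/eqP->; rewrite ?h2 //; by [left|right].
- by move=> _ e; have := iP q'; rewrite -e eqxx.
- by move=> _ e; have := iP q; rewrite e eqxx.
exact: h4.
Qed.

End Codes.

(** * Double counting and the moments of the number of unlabelled positions *)

Lemma double_count (A B X Y : finType) (SA : {set A}) (SB : {set B})
    (FX : A -> {set X}) (FY : B -> {set Y}) (f : A -> X -> B * Y) :
  (forall a x, a \in SA -> x \in FX a ->
     (f a x).1 \in SB /\ (f a x).2 \in FY (f a x).1) ->
  (forall a x a' x', a \in SA -> x \in FX a -> a' \in SA -> x' \in FX a' ->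
     f a x = f a' x' -> a = a' /\ x = x') ->
  \sum_(a in SA) #|FX a| <= \sum_(b in SB) #|FY b|.
Proof.
move=> fP f_inj.
have sumE (C Z : finType) (S : {set C}) (F : C -> {set Z}) :
    \sum_(c in S) #|F c| = #|[set u | (u.1 \in S) && (u.2 \in F u.1)]%SET|.
  under eq_bigr => c _ do rewrite -sum1_card.
  by rewrite pair_big_dep -sum1_card /=; apply: eq_bigl => u; rewrite inE.
rewrite !sumE -(card_in_imset (f := fun u => f u.1 u.2)).
  apply/subset_leq_card/fintype.subsetP => _ /imsetP[[a x]/= + ->].
  by rewrite !inE /= => /andP[aS xF]; have [-> ->] := fP _ _ aS xF.
move=> [a x] [a' x']; rewrite !inE /= => /andP[aS xF] /andP[aS' xF'] e.
by have [-> ->] := f_inj _ _ _ _ aS xF aS' xF' e.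
Qed.

Lemma sum_unl_sqr N :
  \sum_(c in codes N) unl c ^ 2 <= 4 * N * #|codes N|.
Proof.
suff: \sum_(c in codes N)
    #|finset.setX [set p | lbl c p == None]%SET (unused c)| <=
    \sum_(c in codes N) #|[set: 'I_N.*2]%SET|.
  rewrite sum_nat_const cardsT card_ord => le.
  have : \sum_(c in codes N) unl c ^ 2 <= \sum_(c in codes N)
      2 * #|finset.setX [set p | lbl c p == None]%SET (unused c)|.
    apply: leq_sum => c cP; rewrite cardsX -/(unl c) -mulnn.
    by have := card_unused cP; nia.
  rewrite -big_distrr /= => h; apply: leq_trans h _.
  by apply: leq_trans (leq_mul (leqnn 2) le) _; move: #|codes N| => a; nia.
apply: (@double_count _ _ _ _ _ _ _ (fun=> [set: 'I_N.*2]%SET)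
  (fun c x => (set_label c x.1 x.2, x.1))) => [c [p i] cP|].
  rewrite finset.in_setX [_ \in [set _ | _]%SET]inE /= => /andP[/eqP lp iP].
  by rewrite finset.in_setT set_label_codes.
move=> c [p i] c' [p' i'] cP + cP'; rewrite !finset.in_setX.
rewrite ![_ \in [set _ | _]%SET]inE /=.
move=> /andP[/eqP lp iP] /andP[/eqP lp' iP'] [/ffunP e ep]; subst p'.
have em q : mate c q = mate c' q by have := e q; rewrite !ffunE => -[].
have [_ _ h3 _] := codesP _ cP; have [_ _ h3' _] := codesP _ cP'.
split; last by have := e p; rewrite !ffunE eqxx /= => -[_ ->].
apply/ffunP => q; rewrite [LHS]surjective_pairing [RHS]surjective_pairing.
rewrite -!/(mate _ _) -!/(lbl _ _) em; congr (_, _).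
(* Off the pair of [p] the old label is still visible; on that pair both old codes are
   unlabelled. *)
have := e q; rewrite !ffunE -!em => -[]; case: ifP => [qp _|_ //].
by case/orP: qp => /eqP->; [rewrite lp lp'|rewrite h3 em h3' lp lp'].
Qed.

(** The first moment follows from the second by [2ab <= a^2 + b^2] with [a = 2 * K * unl c] and
    [b = N]. From the threshold [16 * K ^ 2] on, the second moment term is at most
    [N ^ 2 * #|codes N|]. *)
Lemma sum_unl_small K : exists N0, forall N, N0 <= N ->
  K * \sum_(c in codes N) unl c <= N * #|codes N|.
Proof.
exists (16 * K ^ 2 + 1) => N leN.
have : \sum_(c in codes N) 4 * K * N * unl c <=
    \sum_(c in codes N) (4 * K ^ 2 * unl c ^ 2 + N ^ 2).
  apply: leq_sum => c _; have [+ _] := nat_Cauchy (2 * K * unl c) N.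
  by rewrite -!mulnn; move: (unl c) => u; lia.
rewrite big_split -!big_distrr /= sum_nat_const.
have := sum_unl_sqr N.
set s := \sum_(c in _) _ ^ 2; set t := \sum_(c in _) _.
move: #|codes N| => u h1 h2.
have h3 : 4 * K * N * t <= 4 * K ^ 2 * (4 * N * u) + N ^ 2 * u.
  apply: leq_trans h2 _; by have := leq_mul (leqnn (4 * K ^ 2)) h1; lia.
have h4 : N * (4 * K * t) <= N * (2 * N * u) by nia.
by move: h4; rewrite leq_pmul2l; nia.
Qed.

(** * Exploration of a random code *)

HB.instance Definition _ := gen_eqMixin dec_vertex.

Section NatPositions.
Variable N : nat.
Implicit Types (c : pcode N) (p q z : 'I_N.*2).

(** The identity beyond [N.*2]: positions computed by adding offsets can be plain naturals, and
    [partnerK] holds without a bound. *)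
Definition partner c (p : nat) : nat :=
  if insub p is Some q then val (mate c q) else p.
Definition label c (p : nat) : option 'I_N.+1 := obind (lbl c) (insub p).
Definition labelled c (p : nat) : bool := label c p.

Lemma partnerE c p : partner c p = mate c p.
Proof. by rewrite /partner valK. Qed.

Lemma labelE c p : label c p = lbl c p.
Proof. by rewrite /label valK. Qed.

Lemma label_lt c (p : nat) : label c p -> p < N.*2.
Proof. by rewrite /label; case: insubP => [u + _ _|]. Qed.

Lemma partner_lt c (p : nat) : p < N.*2 -> partner c p < N.*2.
Proof. by move=> lp; rewrite (partnerE c (Ordinal lp)) ltn_ord. Qed.

Lemma partnerK c (p : nat) : c \in codes N -> partner c (partner c p) = p.
Proof.
move=> /codesP[_ h _ _]; rewrite {2}/partner; case: insubP => [u _ <-|].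
  by rewrite partnerE h.
by rewrite /partner; case: insubP => // u ->.
Qed.

Lemma partner_neq c (p : nat) : c \in codes N -> p < N.*2 -> partner c p != p.
Proof. by move=> /codesP[h _ _ _] lp; rewrite (partnerE c (Ordinal lp)); apply: h. Qed.

Lemma label_partner c (p : nat) : c \in codes N -> label c (partner c p) = label c p.
Proof.
move=> /codesP[_ _ h _]; rewrite /partner; case: insubP => // u _ <-.
by rewrite !labelE h.
Qed.

Lemma label_inj c (p q : nat) : c \in codes N -> label c p ->
  label c p = label c q -> q = p \/ q = partner c p.
Proof.
move=> /codesP[_ _ _ h] lp e.
have pP := label_lt lp; have qP : q < N.*2 by apply: (@label_lt c); rewrite -e.
have := h (Ordinal pP) (Ordinal qP); rewrite -!labelE /= => /(_ lp e)[]/(congr1 val)/= ->.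
  by left.
by right; rewrite -partnerE.
Qed.

Lemma partner_swap c q z (p : nat) :
  p != q -> p != z -> partner c p != q -> partner c p != z ->
  partner (swap c q z) p = partner c p.
Proof.
rewrite /partner; case: insubP => // u _ <- uq uz.
by rewrite mate_swap => mq mz; rewrite !tpermD // eq_sym.
Qed.

Lemma labelled_swap c q z (p : nat) : labelled c q -> labelled c z ->
  labelled (swap c q z) p = labelled c p.
Proof.
rewrite /labelled !labelE /label; case: insubP => //= u _ _ lq lz.
by rewrite lbl_swap; case: tpermP => // ->; rewrite lq lz.
Qed.

End NatPositions.

Lemma card_in_seq n (l : seq nat) : #|[set q : 'I_n | (q : nat) \in l]%SET| <= size l.
Proof.
rewrite cardE -(size_map val); apply: uniq_leq_size.
  by rewrite (map_inj_uniq val_inj) enum_uniq.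
by move=> _ /mapP[x + ->]; rewrite mem_enum inE.
Qed.

(** * Events of vanishing probability *)

Definition negl (B : forall N, pcode N -> bool) : Prop :=
  forall K, exists N0, forall N, N0 <= N ->
    K * #|[set c in codes N | B N c]%SET| <= #|codes N|.

Lemma negl_or (B1 B2 B : forall N, pcode N -> bool) : negl B1 -> negl B2 ->
  (forall N c, c \in codes N -> B N c -> B1 N c || B2 N c) -> negl B.
Proof.
move=> h1 h2 sub K; have [N1 l1] := h1 (2 * K); have [N2 l2] := h2 (2 * K).
exists (maxn N1 N2) => N; rewrite geq_max => /andP[/l1 {}l1 /l2 {}l2].
have : #|[set c in codes N | B N c]%SET| <=
    #|[set c in codes N | B1 N c]%SET| + #|[set c in codes N | B2 N c]%SET|.
  rewrite -cardsUI; apply: leq_trans (leq_addr _ _); apply/subset_leq_card.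
  apply/fintype.subsetP => c; rewrite finset.in_setU ![_ \in [set _ in _ | _]%SET]inE.
  by move=> /andP[cc] /(sub _ _ cc); rewrite cc.
by move: l1 l2; move: #|_| #|_| #|_| #|_|; nia.
Qed.

Lemma negl_sub (B1 B : forall N, pcode N -> bool) : negl B1 ->
  (forall N c, c \in codes N -> B N c -> B1 N c) -> negl B.
Proof. by move=> h sub; apply: (negl_or h h) => N c cc /(sub _ _ cc)->. Qed.

(** Markov's inequality. Away from this event at least [N] positions are labelled and can serve in a
    switching. *)
Lemma negl_unl : negl (fun N c => N < unl c).
Proof.
move=> K; have [N0 h] := sum_unl_small K; exists N0.+1 => N lN.
have {h} := h N (ltnW lN).
have : N * #|[set c in codes N | N < unl c]%SET| <= \sum_(c in codes N) unl c.
  rewrite -sum1_card big_distrr /= [X in _ <= X](bigID (fun c => N < unl c)) /=.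
  apply: leq_trans (leq_addr _ _); under eq_bigl do rewrite inE.
  by apply: leq_sum => c /andP[_ /ltnW]; rewrite muln1.
set a := #|[set _ in _ | _]%SET|; set b := \sum_(_ in _) _.
move: #|codes N| => d h1 h2.
have : N * (K * a) <= N * d by nia.
by rewrite leq_pmul2l; lia.
Qed.

(** Switching [t] with an arbitrary [z] makes [z] unlabelled, so a bad code yields [N.*2] pairs of a
    code and one of its unlabelled positions. *)
Lemma negl_unlabelled t : negl (fun N c => ~~ labelled c t).
Proof.
move=> K; have [N0 h] := sum_unl_small K; exists (N0 + t.+1) => N lN.
have {h} := h N _; rewrite (leq_trans (leq_addr _ _) lN) => /(_ isT).
have tP : t < N.*2 by lia.
pose t' := Ordinal tP.
have := @double_count _ _ _ _ [set c in codes N | ~~ labelled c t]%SET (codes N)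
  (fun=> [set: 'I_N.*2]%SET) (fun c => [set p | lbl c p == None]%SET)
  (fun c z => (swap c t' z, z)).
rewrite sum_nat_const cardsT card_ord => dc.
have {dc} : #|[set c in codes N | ~~ labelled c t]%SET| * N.*2 <=
    \sum_(c in codes N) unl c.
  apply: dc => [c z|c z c' z' _ _ _ _ [e ez]]; last first.
    by subst z'; split=> //; rewrite -(swapK c t' z) e swapK.
  rewrite inE => /andP[cc lt] _; split; first exact: swap_codes.
  rewrite inE lbl_swap tpermR; move: lt.
  by rewrite /labelled (labelE c t'); case: (lbl c t').
set a := #|[set _ in _ | _]%SET|; set b := \sum_(_ in _) _.
move: #|codes N| => d h1 h2.
have : N * (K * a) <= N * d by nia.
by rewrite leq_pmul2l; lia.
Qed.

(** Where the vertex [x] of the limit is expected in the word: spines become intervals, and the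
    passage from [y] to [w(y)] becomes the passage to the partner. *)
Fixpoint pos N (c : pcode N) (x : dec_vertex) : nat :=
  match x with
  | RootSpine t => t
  | Before y k => partner c (pos c y) - k.+1
  | After y k => partner c (pos c y) + k.+1
  end.

Definition wpos N (c : pcode N) x := partner c (pos c x).

(** * Windows and their exploration *)

Section Windows.
Variable D : nat.
Implicit Types (s : seq dec_vertex) (x y : dec_vertex).

(* If [q < D], truncated subtraction puts 0 in the window; as 0 is also a
   position of the root window, [ok] then fails. *)
Definition win (q : nat) : seq nat :=
  locked [seq q + d - D | d <- iota 0 D.*2.+1].

Lemma winE q : win q = [seq q + d - D | d <- iota 0 D.*2.+1].
Proof. by rewrite /win -lock. Qed.

Definition occ N (c : pcode N) s : seq nat :=
  iota 0 D ++ flatten [seq win (wpos c x) | x <- s].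

Definition ok N (c : pcode N) s : bool :=
  uniq (occ c s) && all (labelled c) (occ c s).

(** Membership in [s] means that the window around the partner has been opened; availability means
    that the position itself lies in the root window or in an opened one. So [wf s] asks that every
    window was opened from an available vertex. *)
Definition avail s x : bool :=
  match x with
  | RootSpine t => t < D
  | Before y k | After y k => (y \in s) && (k < D)
  end.

Definition wf s : Prop := forall x, x \in s -> avail s x.

Lemma avail_sub s s' x : {subset s <= s'} -> avail s x -> avail s' x.
Proof. by move=> ss; case: x => //= y k /andP[/ss-> ->]. Qed.

Lemma wf_cons s x : wf s -> avail s x -> wf (x :: s).
Proof.
move=> w a y; rewrite inE => /orP[/eqP->|/w w']; apply: (@avail_sub s) => // z zs;
  by rewrite inE zs orbT.
Qed.

Section Code.
Variables (N : nat) (c : pcode N).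

Lemma mem_win q d : d <= D.*2 -> q + d - D \in win q.
Proof. by move=> ld; rewrite winE; apply/mapP; exists d => //; rewrite mem_iota; lia. Qed.

Lemma win_occ s x p : x \in s -> p \in win (wpos c x) -> p \in occ c s.
Proof.
move=> xs pw; rewrite /occ mem_cat; apply/orP; right; apply/flattenP.
by exists (win (wpos c x)) => //; apply: map_f.
Qed.

Lemma win_inj s x y p : uniq (occ c s) -> x \in s -> y \in s ->
  p \in win (wpos c x) -> p \in win (wpos c y) -> x = y.
Proof.
rewrite /occ cat_uniq => /and3P[_ _]; elim: s => //= a s IH.
rewrite cat_uniq ![_ \in a :: s]in_cons => /and3P[_ dis u].
have nod z : z \in s -> p \in win (wpos c a) -> p \in win (wpos c z) -> False.
  move=> zs pa pz; move: dis => /negP; apply; apply/hasP; exists p => //.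
  by apply/flattenP; exists (win (wpos c z)) => //; apply: map_f.
by move=> /orP[/eqP->|xs] /orP[/eqP->|ys] // px py;
  [case: (nod y ys)|case: (nod x xs)|apply: IH].
Qed.

Lemma win_root s x t : uniq (occ c s) -> x \in s -> t < D ->
  t \in win (wpos c x) -> False.
Proof.
rewrite /occ cat_uniq => /and3P[_ /negP dis _] xs tD tw.
apply: dis; apply/hasP; exists t; last by rewrite mem_iota.
by apply/flattenP; exists (win (wpos c x)) => //; apply: map_f.
Qed.

Lemma win_offset s x d d' : uniq (occ c s) -> x \in s -> d <= D.*2 ->
  d' <= D.*2 -> wpos c x + d - D = wpos c x + d' - D -> d = d'.
Proof.
rewrite /occ cat_uniq => /and3P[_ _ u] xs ld ld' e.
have {u} : uniq (win (wpos c x)).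
  elim: s xs u => //= a s IH; rewrite [_ \in a :: s]in_cons cat_uniq => /orP[/eqP->|xs] /and3P[] //.
  by move=> _ _; apply: IH.
rewrite winE => /(uniqP 0)/(_ d d'); rewrite !inE size_map size_iota !ltnS.
by move=> /(_ ld ld'); apply; rewrite !(nth_map 0) ?size_iota ?nth_iota ?ltnS.
Qed.

(** A single offset between 0 and [D.*2], with [w(y)] at [D], lets both halves of a spine be treated
    at once. *)
Definition at_offset y d : dec_vertex :=
  if d < D then Before y (D - d.+1) else After y (d - D.+1).

Lemma availP s x : avail s x ->
  (exists2 t, t < D & x = RootSpine t) \/
  exists y d, [/\ y \in s, d <= D.*2, d != D, x = at_offset y d &
    pos c x = wpos c y + d - D].
Proof.
case: x => [t|y k|y k] /=; first by left; exists t.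
- move=> /andP[ys kD]; right; exists y, (D - k.+1); rewrite -/(wpos c y).
  rewrite /at_offset ifT; last by lia.
  by split=> //; try lia; congr (Before _ _); lia.
- move=> /andP[ys kD]; right; exists y, (D + k.+1); rewrite -/(wpos c y).
  rewrite /at_offset ifF; last by lia.
  by split=> //; try lia; congr (After _ _); lia.
Qed.

Lemma pos_occ s x : avail s x -> pos c x \in occ c s.
Proof.
move=> /availP[[t tD ->]|[y [d [ys ld _ _ ->]]]].
  by rewrite /occ mem_cat mem_iota tD.
by apply: (win_occ ys); apply: mem_win.
Qed.

Lemma wpos_win x : wpos c x \in win (wpos c x).
Proof. by rewrite -{1}(addnK D (wpos c x)); apply: mem_win; lia. Qed.

Lemma pos_inj s x y : uniq (occ c s) -> avail s x -> avail s y ->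
  pos c x = pos c y -> x = y.
Proof.
move=> u /availP[[t tD ->]|[x' [d [xs ld _ -> ->]]]]
  /availP[[t' tD' ->]|[y' [d' [ys ld' _ -> ->]]]] /= e.
- by rewrite e.
- by case: (win_root u ys tD); rewrite e mem_win.
- by case: (win_root u xs tD'); rewrite -e mem_win.
have xy : x' = y'.
  by apply: (win_inj u xs ys (mem_win _ ld)); rewrite e mem_win.
by subst y'; rewrite (win_offset u xs ld ld' e).
Qed.

Lemma pos_wpos s x y : uniq (occ c s) -> avail s x -> y \in s ->
  pos c x != wpos c y.
Proof.
move=> u /availP[[t tD ->]|[x' [d [xs ld dD _ ->]]]] ys; apply/eqP => /= e.
  by case: (win_root u ys tD); rewrite e wpos_win.
have xy : x' = y by apply: (win_inj u xs ys (mem_win _ ld)); rewrite e wpos_win.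
subst x'; move: dD; rewrite (@win_offset s y d D) ?eqxx //; first by lia.
by rewrite e addnK.
Qed.

(** Partners around which a new window may fail: too close to an end of the word, or with an
    occupied or unlabelled position within distance [D]. The code enters only through its occupied
    and its unlabelled positions, so a switching can preserve this list. *)
Definition forbidden s : seq nat :=
  iota 0 D ++ iota (N.*2 - D) D ++
  [seq a + D - d | a <- occ c s ++ [seq p <- iota 0 N.*2 | ~~ labelled c p],
                   d <- iota 0 D.*2.+1].

Lemma forbiddenP s y : c \in codes N -> ok c s -> avail s y -> ~~ ok c (y :: s) ->
  wpos c y \in forbidden s.
Proof.
move=> cc okc av; apply: contraR.
have ly : labelled c (wpos c y).
  rewrite /labelled label_partner //; have /andP[_ /allP] := okc; apply.
  exact: pos_occ.
have := label_lt ly; move qE: (wpos c y) => q qP.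
rewrite /forbidden !mem_cat !negb_or !mem_iota => /and3P[qD qPD /negP nof].
have no a d : d <= D.*2 -> q + d - D = a ->
    a \in occ c s ++ [seq p <- iota 0 N.*2 | ~~ labelled c p] -> False.
  move=> ld e xi; apply: nof; apply/allpairsPdep; exists a, d; rewrite mem_iota xi; split=> //; lia.
have nocc d : d <= D.*2 -> q + d - D \notin occ c s.
  by move=> ld; apply/negP => h; apply: (no _ d ld erefl); rewrite mem_cat h.
have lab d : d <= D.*2 -> labelled c (q + d - D).
  move=> ld; apply/negPn/negP => h; apply: (no _ d ld erefl).
  by rewrite mem_cat mem_filter h mem_iota; apply/orP; right; lia.
have /andP[u al] := okc; rewrite /ok /occ /= qE uniq_catCA cat_uniq -/(occ c s) winE.
move: al; rewrite !all_cat => /andP[al1 al2]; rewrite al1 al2 u !andbT.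
apply/andP; split; [apply/andP; split|].
- rewrite map_inj_in_uniq ?iota_uniq // => d d'; rewrite !mem_iota; lia.
- apply/negP => /hasP[p pocc /mapP[d]]; rewrite mem_iota ltnS => ld e.
  by move: (nocc d ld); rewrite -e pocc.
- by apply/allP => p /mapP[d]; rewrite mem_iota ltnS => ld ->; apply: lab.
Qed.

Lemma size_unl : size [seq p <- iota 0 N.*2 | ~~ labelled c p] = unl c.
Proof.
rewrite -val_enum_ord filter_map size_map enumT /unl cardE /enum_mem !size_filter.
by apply: eq_count => p; rewrite /= inE /labelled labelE; case: (lbl c p).
Qed.

Lemma size_occ s : size (occ c s) = D + size s * D.*2.+1.
Proof.
rewrite size_cat size_iota; congr (_ + _).
by elim: s => //= a s IH; rewrite size_cat IH winE size_map size_iota.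
Qed.

Lemma size_forbidden s :
  size (forbidden s) = D.*2 + (D + size s * D.*2.+1 + unl c) * D.*2.+1.
Proof.
by rewrite !size_cat size_allpairs size_cat size_unl size_occ !size_iota addnA addnn.
Qed.

End Code.

(* Switching: the partner [q] of [y] is exchanged with a labelled position [z].
   The windows already explored do not change, so from the new code and [q],
   which lies in a short list determined by the new code, one recovers [z] as
   the new partner of [y], and then the old code. *)
Section Switch.
Variables (N : nat) (c : pcode N) (s : seq dec_vertex) (y : dec_vertex).
Hypotheses (cc : c \in codes N) (okc : ok c s) (wfs : wf s) (av : avail s y)
  (ys : y \notin s).

Definition touched := pos c y :: map (pos c) s ++ map (wpos c) s.

Variables q z : 'I_N.*2.
Hypotheses (qE : q = wpos c y :> nat) (lz : labelled c z) (zT : (z : nat) \notin touched).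

Let c' := swap c q z.

Let u : uniq (occ c s). Proof. by have /andP[] := okc. Qed.

Let ly : labelled c (pos c y).
Proof. by have /andP[_ /allP] := okc; apply; apply: pos_occ. Qed.

Let lq : labelled c q.
Proof. by rewrite qE /labelled label_partner. Qed.

(** This keeps the explored part fixed under the swap. For [z] it is [zT]; for [q] it is the
    disjointness of the windows, since a coincidence would put [y] at a known partner or at the
    position of a member of [s]. *)
Let pos_neq x : x \in s -> [/\ pos c x != q, pos c x != z, wpos c x != q & wpos c x != z].
Proof.
move=> xs; have := zT; rewrite inE mem_cat !negb_or => /and3P[_ /negP z1 /negP z2].
split.
- rewrite qE; apply/eqP => e; have /negP := pos_wpos u av xs; apply.
  by rewrite /wpos e /wpos partnerK.
- by apply/eqP => e; apply: z1; rewrite -e; apply: map_f.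
- rewrite qE; apply/eqP => e; move: ys; rewrite -(@pos_inj N c s x y) ?xs //.
    exact: wfs.
  by rewrite -[LHS](partnerK _ cc) -[RHS](partnerK _ cc) -/(wpos c x) e.
- by apply/eqP => e; apply: z2; rewrite -e; apply: map_f.
Qed.

(** Structural induction: the position of [x] is computed from the partner of the vertex that
    created its spine, which is in [s] by [wfs]. *)
Lemma switch_pos x : x \in s -> pos c' x = pos c x /\ wpos c' x = wpos c x.
Proof.
have wE a : a \in s -> pos c' a = pos c a -> wpos c' a = wpos c a.
  by move=> /pos_neq[p1 p2 p3 p4] e; rewrite /wpos e /c' partner_swap.
elim: x => [t|x IH k|x IH k] xs.
- by split=> //; apply: wE.
- have /andP[/IH[_ e] _] := wfs xs.
  have pe : pos c' (Before x k) = pos c (Before x k) by rewrite /= -!/(wpos _ x) e.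
  by split=> //; apply: wE.
- have /andP[/IH[_ e] _] := wfs xs.
  have pe : pos c' (After x k) = pos c (After x k) by rewrite /= -!/(wpos _ x) e.
  by split=> //; apply: wE.
Qed.

Lemma switch_pos_new : pos c' y = pos c y.
Proof.
by move: av; case: (y) => //= x k /andP[/switch_pos[_ e] _]; rewrite -!/(wpos _ x) e.
Qed.

Lemma switch_wpos_new : wpos c' y = z.
Proof.
rewrite /wpos switch_pos_new.
have pP : pos c y < N.*2 by apply: label_lt ly.
have pq : pos c y != q by rewrite qE eq_sym partner_neq.
have pz : pos c y != z.
  by have := zT; rewrite inE negb_or eq_sym => /andP[].
rewrite /c' (partnerE _ (Ordinal pP)) mate_swap.
rewrite [tperm q z (Ordinal pP)]tpermD -?val_eqE 1?eq_sym //.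
suff -> : mate c (Ordinal pP) = q by rewrite tpermL.
by apply/val_inj; rewrite /= -partnerE qE.
Qed.

Lemma switch_labelled p : labelled c' p = labelled c p.
Proof. exact: labelled_swap. Qed.

Lemma switch_occ : occ c' s = occ c s.
Proof.
rewrite /occ; congr (_ ++ flatten _).
by apply/eq_in_map => x /switch_pos[_ ->].
Qed.

Lemma switch_forbidden : forbidden c' s = forbidden c s.
Proof.
rewrite /forbidden switch_occ; congr (_ ++ (_ ++ _)).
by congr (allpairs _ (_ ++ _) _); apply: eq_filter => p; rewrite switch_labelled.
Qed.

End Switch.

(** Of the [N.*2] positions at most [N] are unlabelled and at most [(size s).*2.+1] are touched,
    which bounds the number of choices of [z] from below. The right-hand side adds up the lengths of
    the lists [forbidden]. *)
Lemma card_not_ok N s y : wf s -> avail s y -> y \notin s ->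
  #|[set c in codes N | [&& unl c <= N, ok c s & ~~ ok c (y :: s)]]%SET|
    * (N - (size s).*2.+1) <=
  (D.*2 + (D + size s * D.*2.+1) * D.*2.+1) * #|codes N| +
  D.*2.+1 * \sum_(c in codes N) unl c.
Proof.
move=> wfs av ys.
(* For [N = 0] there is no position to serve as default of [insubd]. *)
have [->|N0] := posnP N; first by rewrite sub0n muln0.
have P0 : 0 < N.*2 by rewrite double_gt0.
pose q (c : pcode N) : 'I_N.*2 := insubd (Ordinal P0) (wpos c y).
have qE c : c \in codes N -> ok c s -> q c = wpos c y :> nat.
  move=> cc okc; rewrite val_insubd ifT //; apply: partner_lt; apply: (@label_lt _ c).
  by have /andP[_ /allP] := okc; apply; apply: pos_occ.
pose S := [set c in codes N | [&& unl c <= N, ok c s & ~~ ok c (y :: s)]]%SET.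
pose F (c : pcode N) : {set 'I_N.*2} :=
  [set z : 'I_N.*2 | labelled c z && ((z : nat) \notin touched c s y)]%SET.
pose G (c : pcode N) : {set 'I_N.*2} := [set q : 'I_N.*2 | (q : nat) \in forbidden c s]%SET.
have SP c : c \in S -> [/\ c \in codes N, unl c <= N, ok c s & ~~ ok c (y :: s)].
  by rewrite inE => /andP[cc /and3P[]].
have FP (c : pcode N) (z : 'I_N.*2) : z \in F c -> labelled c z /\ (z : nat) \notin touched c s y.
  by rewrite inE => /andP[].
apply: (@leq_trans (\sum_(c in S) #|F c|)).
  rewrite -sum_nat_const; apply: leq_sum => c /SP[cc uc _ _].
  have := card_in_seq N.*2 (touched c s y).
  rewrite {2}/touched /= size_cat !size_map addnn => tz.
  have : #|[set: 'I_N.*2]%SET| <= #|F c| + (#|[set p | lbl c p == None]%SET| +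
      #|[set z : 'I_N.*2 | (z : nat) \in touched c s y]%SET|).
    apply: leq_trans (leq_add (leqnn _) (leq_card_setU _ _)).
    apply: leq_trans (leq_card_setU _ _); apply/subset_leq_card/fintype.subsetP => z _.
    rewrite !finset.in_setU !finset.in_set /labelled labelE /=.
    by case: (lbl c z) => //=; case: (_ \in _).
  rewrite cardsT card_ord -/(unl c) => h.
  have := leq_trans h (leq_add (leqnn _) (leq_add uc tz)).
  by move: #|F c| => f; lia.
apply: (@leq_trans (\sum_(c in codes N) #|G c|)).
  apply: (@double_count _ _ _ _ _ _ _ _ (fun c z => (swap c (q c) z, q c))).
    move=> c z /SP[cc uc okc nok] /FP[lz zT]; split; first exact: swap_codes.
    have qc := qE _ cc okc; rewrite inE (switch_forbidden cc okc wfs av ys qc lz zT) /=.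
    by rewrite qc; apply: forbiddenP.
  move=> c z c' z' /SP[cc uc okc nok] /FP[lz zT] /SP[cc' uc' okc' nok'] /FP[lz' zT'] [e eq].
  have := switch_wpos_new cc okc wfs av ys (qE _ cc okc) zT.
  rewrite e (switch_wpos_new cc' okc' wfs av ys (qE _ cc' okc') zT') => ez.
  have {}ez : z = z' by apply: val_inj.
  by subst z'; split=> //; rewrite -(swapK c (q c) z) e eq swapK.
apply: (@leq_trans (\sum_(c in codes N)
    (D.*2 + (D + size s * D.*2.+1) * D.*2.+1 + D.*2.+1 * unl c))).
  apply: leq_sum => c _; apply: leq_trans (card_in_seq _ _) _.
  by rewrite size_forbidden; lia.
by rewrite big_split /= sum_nat_const -big_distrr /= leq_add2r mulnC.
Qed.

Lemma negl_cons s y : wf s -> avail s y -> y \notin s ->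
  negl (fun N c => ~~ ok c s) -> negl (fun N c => ~~ ok c (y :: s)).
Proof.
move=> wfs av ys no.
have no2 : negl (fun N c => [&& unl c <= N, ok c s & ~~ ok c (y :: s)]).
  move=> K; pose A := D.*2 + (D + size s * D.*2.+1) * D.*2.+1.
  have [N0 h] := sum_unl_small (4 * K * D.*2.+1).
  (* After multiplication by [4 * K] each of the two terms of [card_not_ok] is at most
     [N * #|codes N|]; moreover [N - (size s).*2.+1] is at least half of [N]. *)
  exists (N0 + 4 * K * A + 2 * (size s).*2.+1 + 1) => N lN.
  have {h} := h N; rewrite (leq_trans _ lN) => [/(_ isT)|]; last by lia.
  have := card_not_ok N wfs av ys; rewrite -/A.
  set a := #|[set _ in _ | _]%SET|; set b := \sum_(_ in _) _.
  move: #|codes N| A D.*2.+1 (size s).*2.+1 lN => d A' B' z lN h1 h2.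
  have h3 : N * (K * a) <= 2 * K * (a * (N - z)) by nia.
  have h4 : 2 * (N * (K * a)) <= 2 * (N * d) by nia.
  by move: h4; rewrite !leq_pmul2l; lia.
have no1 : negl (fun N c => (N < unl c) || ~~ ok c s) by apply: negl_or negl_unl no _.
apply: (negl_or no1 no2) => N c _ ->; rewrite andbT.
by case: leqP => //= _; case: (ok c s).
Qed.

Lemma negl_nil : negl (fun N c => ~~ ok c [::]).
Proof.
suff : negl (fun N c => ~~ all (labelled c) (iota 0 D)).
  by move=> h; apply: (negl_sub h) => N c _; rewrite /ok /occ /= cats0 iota_uniq.
elim: D => [|d IH].
  by move=> K; exists 0 => N _; rewrite (_ : [set _ in _ | _]%SET = finset.set0)
    ?cards0 ?muln0 //; apply/setP => c; rewrite !inE andbF.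
apply: (negl_or IH (negl_unlabelled d)) => N c _.
by rewrite -addn1 iotaD all_cat /= andbT negb_and.
Qed.

Fixpoint bounded x : bool :=
  match x with
  | RootSpine t => t < D
  | Before y k | After y k => bounded y && (k < D)
  end.

(** Each vertex is added after the one that created its spine, so that it is available when its
    window is opened and [negl_cons] applies. *)
Lemma negl_cover (l : seq dec_vertex) : all bounded l ->
  exists s, [/\ wf s, {subset l <= s} & negl (fun N c => ~~ ok c s)].
Proof.
have add s y : wf s -> avail s y -> negl (fun N c => ~~ ok c s) ->
    exists s', [/\ wf s', {subset s <= s'}, y \in s' & negl (fun N c => ~~ ok c s')].
  move=> w a no; have [ys|ys] := boolP (y \in s); first by exists s; split.
  exists (y :: s); split; [exact: wf_cons| |by rewrite inE eqxx|exact: negl_cons].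
  by move=> z zs; rewrite inE zs orbT.
have cov x s : bounded x -> wf s -> negl (fun N c => ~~ ok c s) ->
    exists s', [/\ wf s', {subset s <= s'}, x \in s' & negl (fun N c => ~~ ok c s')].
  elim: x s => [t|x IH k|x IH k] s /=; first by move=> tD w; apply: add.
  - move=> /andP[bx kD] w no; have [s1 [w1 ss1 xs1 no1]] := IH s bx w no.
    have [|s2 [w2 ss2 xs2 no2]] := add s1 (Before x k) w1 _ no1.
      by rewrite /= xs1.
    by exists s2; split=> // z /ss1/ss2.
  - move=> /andP[bx kD] w no; have [s1 [w1 ss1 xs1 no1]] := IH s bx w no.
    have [|s2 [w2 ss2 xs2 no2]] := add s1 (After x k) w1 _ no1.
      by rewrite /= xs1.
    by exists s2; split=> // z /ss1/ss2.
elim: l => [_|x l IH /= /andP[bx /IH[s [w ls no]]]].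
  by exists [::]; split=> //; exact: negl_nil.
have [s' [w' ss' xs' no']] := cov x s bx w no.
exists s'; split=> // z; rewrite inE => /orP[/eqP->//|/ls]; exact: ss'.
Qed.

End Windows.

(** Reversal of the word has no fixed position because [N.*2] is even. *)
Lemma codes_gt0 N : 0 < #|codes N|.
Proof.
apply/card_gt0P; exists [ffun p => (rev_ord p, None)]; apply/codesP.
have mE p : mate [ffun p => (rev_ord p, None)] p = rev_ord p :> 'I_N.*2.
  by rewrite /mate ffunE.
have lE p : lbl [ffun p => (rev_ord p, None)] p = None :> option 'I_N.+1.
  by rewrite /lbl ffunE.
split=> [p|p|p|p q]; rewrite ?mE ?rev_ordK ?lE //.
by rewrite -val_eqE /=; have := ltn_ord p; lia.
Qed.

(** * The network of a code *)

(** One type for all codes with the same [N], tree vertices being plain positions: the networks of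
    two codes can be compared without transport, and only [verts c] depends on the code. *)
Inductive vtx N := VRoot | VLeaf of 'I_N.+1 | VRet of 'I_N.+1 | VTree of nat.
Arguments VRoot {N}. Arguments VLeaf {N}. Arguments VRet {N}. Arguments VTree {N}.

Section VtxChoice.
Variable N : nat.
Definition vtx_code (v : vtx N) : option ('I_N.+1 + 'I_N.+1 + nat) :=
  match v with
  | VRoot => None
  | VLeaf i => Some (inl (inl i))
  | VRet i => Some (inl (inr i))
  | VTree p => Some (inr p)
  end.
Definition vtx_decode (x : option ('I_N.+1 + 'I_N.+1 + nat)) : vtx N :=
  match x with
  | None => VRoot
  | Some (inl (inl i)) => VLeaf i
  | Some (inl (inr i)) => VRet i
  | Some (inr p) => VTree p
  end.
Lemma vtx_codeK : cancel vtx_code vtx_decode. Proof. by case. Qed.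
HB.instance Definition _ := Choice.copy (vtx N) (can_type vtx_codeK).
End VtxChoice.

Lemma VTreeE N p q : (VTree p == VTree q :> vtx N) = (p == q).
Proof. by apply/eqP/eqP => [[]|->]. Qed.

Section Decode.
Variable N : nat.
Implicit Types (c : pcode N) (p q : nat) (i : 'I_N.+1) (u v : vtx N).

(* Position [p] of the word is the tree vertex [vx c p]. A position is [stale]
   if it is the second occurrence of a vertex with no reticulation child; then
   the path read so far ends in a leaf, and the next one starts at that vertex.
   The extra position [N.*2] ends the last path. Thus [parent c p] is the
   letter before position [p], and [child c p] is its child met there. *)
Definition fresh c p := (p < N.*2) && (labelled c p || (p < partner c p)).
Definition vx c p := if fresh c p then p else partner c p.
Definition stale c := [seq p <- iota 0 N.*2.+1 | ~~ fresh c p].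
Definition tips c : seq 'I_N.+1 := enum (unused c).
Definition tip c p := nth ord0 (tips c) (index p (stale c)).
Definition child c p : vtx N := if fresh c p then VTree p else VLeaf (tip c p).
Definition parent c p : vtx N := if p is p'.+1 then VTree (vx c p') else VRoot.
Definition spot c v :=
  match v with
  | VTree p => p
  | VLeaf i => nth 0 (stale c) (index i (tips c))
  | _ => 0
  end.

Definition verts c : seq (vtx N) :=
  locked (VRoot :: map VLeaf (enum 'I_N.+1) ++
    map VRet (enum (finset.setC (unused c))) ++
    map VTree [seq p <- iota 0 N.*2 | fresh c p]).

(** Edges are described by their head, since the parents of each vertex are explicit; the edges out
    of a vertex are derived in [vedge_out]. *)
Definition vedge c u v : bool :=
  match v with
  | VRoot => false
  | VTree p => u == parent c p
  | VRet i => if u is VTree p then label c p == Some i else false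
  | VLeaf i => if i \in unused c then u == parent c (spot c v) else u == VRet i
  end.

Section Code.
Variable c : pcode N.
Hypothesis cc : c \in codes N.

Lemma fresh_lt p : fresh c p -> p < N.*2. Proof. by case/andP. Qed.

Lemma label_fresh p : label c p -> fresh c p.
Proof. by move=> l; rewrite /fresh (label_lt l) /labelled l. Qed.

Lemma staleP p : p < N.*2 -> ~~ fresh c p ->
  [/\ label c p = None, partner c p < p & fresh c (partner c p)].
Proof.
move=> lp; rewrite /fresh lp negb_or -leqNgt /= => /andP[nl le].
have lt : partner c p < p by rewrite ltn_neqAle le partner_neq.
split=> //; first by move: nl; rewrite /labelled; case: label.
by rewrite partner_lt // partnerK // lt orbT.
Qed.

Lemma vx_le p : p < N.*2 -> vx c p <= p.
Proof. by rewrite /vx => lp; case: ifPn => // /(staleP lp)[_ /ltnW]. Qed.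

Lemma vx_fresh p : p < N.*2 -> fresh c (vx c p).
Proof. by rewrite /vx => lp; case: ifPn => // /(staleP lp)[]. Qed.

Lemma vxE p : fresh c p -> vx c p = p. Proof. by rewrite /vx => ->. Qed.

Lemma vx_eq p q : p < N.*2 -> fresh c q ->
  (vx c p == q) = (p == q) || (label c q == None) && (p == partner c q).
Proof.
move=> lp fq; rewrite /vx; case: ifPn => [fp|/(staleP lp)[lN lt fp]].
  have [//|pq] := eqVneq p q; apply/esym/andP => -[/eqP lq /eqP pE].
  move: fp fq; rewrite /fresh /labelled pE label_partner // lq partnerK //=.
  by move=> /andP[_ h1] /andP[_ h2]; lia.
have [pq|pq] := eqVneq p q.
  by move: fq; rewrite -pq => /[dup]; rewrite {1}/fresh lp /labelled lN /=; lia.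
apply/eqP/andP => [<-|[_ /eqP->]]; last by rewrite partnerK.
by rewrite partnerK // label_partner // lN.
Qed.

Lemma mem_stale p : (p \in stale c) = (p <= N.*2) && ~~ fresh c p.
Proof. by rewrite mem_filter mem_iota /= andbC. Qed.

Lemma uniq_stale : uniq (stale c).
Proof. by rewrite filter_uniq ?iota_uniq. Qed.

(* An unlabelled block has one fresh and one stale position. *)
Lemma size_stale : size (stale c) = size (tips c).
Proof.
rewrite /stale -addn1 iotaD filter_cat size_cat /= {2}/fresh ltnn /=.
rewrite /tips -cardE.
have := card_unused cc; rewrite /unl.
suff -> : #|[set p | lbl c p == None]%SET| =
    2 * size [seq p <- iota 0 N.*2 | ~~ fresh c p] by lia.
have -> : size [seq p <- iota 0 N.*2 | ~~ fresh c p] =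
    #|[set p : 'I_N.*2 | ~~ fresh c p]%SET|.
  rewrite -val_enum_ord filter_map size_map enumT cardE /enum_mem !size_filter.
  by apply: eq_count => p; rewrite /= inE.
have mI : injective (mate c) by case/codesP: cc => _ h _ _; apply: can_inj h.
set A := [set p : 'I_N.*2 | ~~ fresh c p]%SET.
have [_ hK hl _] := codesP _ cc.
rewrite mul2n -[RHS]addnn -[X in _ + X](card_imset A mI) -cardsUI.
have -> : (A :&: [set mate c x | x in A])%SET = finset.set0.
  apply/setP => p; rewrite !inE; apply/andP => -[np /imsetP[p']].
  rewrite inE => np' pE; subst p.
  by have [_ _] := staleP (ltn_ord p') np'; rewrite partnerE (negPf np).
rewrite cards0 addn0; apply: eq_card => p; rewrite !inE.
apply/eqP/orP => [lp|[np|/imsetP[p']]].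
- have [fp|] := boolP (fresh c p); [right|by left].
  apply/imsetP; exists (mate c p); rewrite ?hK // inE.
  move: fp; rewrite /fresh /labelled labelE lp /= ltn_ord partnerE /=.
  by rewrite !labelE !partnerE hl lp hK ltn_ord /=; lia.
- by have [+ _ _] := staleP (ltn_ord p) np; rewrite labelE.
- by rewrite inE => /(staleP (ltn_ord p'))[+ _ _] ->; rewrite labelE hl.
Qed.

Lemma tip_unused p : p \in stale c -> tip c p \in unused c.
Proof.
by move=> ps; rewrite -mem_enum; apply: mem_nth; rewrite -size_stale index_mem.
Qed.

Lemma spot_child p : p <= N.*2 -> spot c (child c p) = p.
Proof.
rewrite /child => lp; case: ifPn => //= np; rewrite /tip.
have ps : p \in stale c by rewrite mem_stale lp.
by rewrite index_uniq ?enum_uniq -?size_stale ?index_mem // nth_index.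
Qed.

Lemma child_inj p q : p <= N.*2 -> q <= N.*2 -> child c p = child c q -> p = q.
Proof. by move=> lp lq e; rewrite -(spot_child lp) e spot_child. Qed.

Lemma spot_leaf i : i \in unused c -> spot c (VLeaf i) \in stale c.
Proof.
by rewrite -mem_enum => it; apply: mem_nth; rewrite size_stale index_mem.
Qed.

Lemma child_leaf i : i \in unused c -> child c (spot c (VLeaf i)) = VLeaf i.
Proof.
move=> it; have := spot_leaf it; rewrite mem_stale /child => /andP[_ /negPf->].
congr VLeaf; rewrite /tip /= index_uniq ?uniq_stale ?nth_index ?mem_enum //.
by rewrite size_stale index_mem mem_enum.
Qed.

Lemma child_fresh p : fresh c p -> child c p = VTree p.
Proof. by rewrite /child => ->. Qed.

Lemma mem_verts v : (v \in verts c) =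
  match v with
  | VRet i => i \notin unused c
  | VTree p => fresh c p
  | _ => true
  end.
Proof.
have no (T : eqType) (f : T -> vtx N) (l : seq T) : (forall x, f x != v) -> v \in map f l = false.
  by move=> h; apply/mapP => -[x _ e]; have := h x; rewrite e eqxx.
rewrite /verts -lock inE !mem_cat; case: v no => [|i|i|p] no //.
- by rewrite mem_map ?mem_enum // => ? ? [].
- rewrite (no _ VLeaf) ?(no _ VTree) ?mem_map //; try by move=> ? ? [].
  by rewrite mem_enum finset.in_setC orbF.
rewrite (no _ VLeaf) ?(no _ VRet) ?mem_map //; try by move=> ? ? [].
by rewrite mem_filter mem_iota andbC /=; apply/andb_idl/fresh_lt.
Qed.

Lemma parent_verts p : p <= N.*2 -> parent c p \in verts c.
Proof. by case: p => [|p] lp; rewrite mem_verts //=; apply: vx_fresh. Qed.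

Lemma child_verts p : child c p \in verts c.
Proof. by rewrite /child mem_verts; case: ifP. Qed.

Lemma vedge_child u p : p <= N.*2 -> vedge c u (child c p) = (u == parent c p).
Proof.
move=> lp; have := spot_child lp; rewrite /child; case: ifPn => // np sE.
by rewrite /vedge tip_unused ?sE // mem_stale lp np.
Qed.

Lemma vertsP v : v \in verts c ->
  [\/ v = VRoot, exists2 i, i \notin unused c & v = VRet i \/ v = VLeaf i |
      exists2 p, p <= N.*2 & v = child c p].
Proof.
rewrite mem_verts; case: v => [|i|i|p] //.
- by constructor 1.
- have [iu _|iu _] := boolP (i \in unused c); [constructor 3|constructor 2].
    exists (spot c (VLeaf i)); last by rewrite child_leaf.
    by have := spot_leaf iu; rewrite mem_stale => /andP[].
  by exists i => //; right.
- by move=> iu; constructor 2; exists i => //; left.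
by move=> fp; constructor 3; exists p; rewrite ?child_fresh // ltnW // fresh_lt.
Qed.

Lemma vedge_out u v : v \in verts c -> vedge c u v ->
  [\/ exists2 p, p <= N.*2 & u = parent c p /\ v = child c p,
      exists2 p, u = VTree p & exists2 i, label c p = Some i & v = VRet i |
      exists2 i, i \notin unused c & u = VRet i /\ v = VLeaf i].
Proof.
move=> /vertsP[->|[i iu [->|->]]|[p lp ->]] //.
- by case: u => //= p /eqP lp; constructor 2; exists p => //; exists i.
- by rewrite /= (negPf iu) => /eqP->; constructor 3; exists i.
by rewrite vedge_child // => /eqP->; constructor 1; exists p.
Qed.

Lemma card_sub_verts (l : seq (vtx N)) (P : pred (vtx N)) :
  uniq l -> {subset l <= verts c} -> {in verts c, P =i l} ->
  #|[pred u : seq_sub (verts c) | P (val u)]| = size l.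
Proof.
move=> ul sl Pl; rewrite cardE -(size_map val); apply/perm_size/uniq_perm => //.
  by rewrite (map_inj_uniq val_inj) enum_uniq.
move=> u; apply/mapP/idP => [[x + ->]|ul'].
  by rewrite mem_enum inE -Pl // ?ssvalP.
by exists (SeqSub (sl _ ul')) => //; rewrite mem_enum inE [P _]Pl //= sl.
Qed.

Lemma root_verts : VRoot \in verts c. Proof. by rewrite mem_verts. Qed.
Lemma leaf_verts i : VLeaf i \in verts c. Proof. by rewrite mem_verts. Qed.

End Code.

Definition net c : network 'I_N.+1 (seq_sub (verts c)) :=
  Network [set e | vedge c (val e.1) (val e.2)]%SET (SeqSub (root_verts c))
    [ffun i => SeqSub (leaf_verts c i)].

End Decode.

(** * The network of a code is a simplex tree-child network *)

Section NetValid.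
Variables (N : nat) (c : pcode N).
Hypothesis cc : c \in codes N.


Lemma net_edgeE (u v : seq_sub (verts c)) : net_edge (net c) u v = vedge c (val u) (val v).
Proof. by rewrite /net_edge inE. Qed.

Lemma val_verts (v : seq_sub (verts c)) : val v \in verts c.
Proof. exact: ssvalP. Qed.

Lemma degreesE (l1 l2 : seq (vtx N)) (v : seq_sub (verts c)) : uniq l1 -> uniq l2 ->
  {subset l1 <= verts c} -> {subset l2 <= verts c} ->
  (forall u : vtx N, u \in verts c -> vedge c u (val v) = (u \in l1)) ->
  (forall u : vtx N, u \in verts c -> vedge c (val v) u = (u \in l2)) ->
  degrees (net c) v = (size l1, size l2).
Proof.
move=> u1 u2 s1 s2 e1 e2; rewrite /degrees; congr (_, _).
  rewrite -(card_sub_verts (P := fun u => vedge c u (val v)) u1 s1 e1).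
  by apply: eq_card => u; rewrite !inE net_edgeE.
rewrite -(card_sub_verts (P := fun u => vedge c (val v) u) u2 s2 e2).
by apply: eq_card => u; rewrite !inE net_edgeE.
Qed.

Lemma used_labels i : i \notin unused c ->
  exists p, [/\ label c p = Some i, label c (partner c p) = Some i,
    partner c p != p & forall q, (label c q == Some i) = (q == p) || (q == partner c p)].
Proof.
move=> /unusedPn[p lp]; have {}lp : label c p = Some i by rewrite labelE.
have l : label c p by rewrite lp.
exists p; rewrite label_partner //; split=> //.
  by rewrite partner_neq // (label_lt l).
move=> q; apply/eqP/orP => [lq|[]/eqP->]; rewrite ?label_partner //.
by have [|->|->] := label_inj cc l (q := q); rewrite ?lp ?lq //; [left|right].
Qed.

Lemma degrees_root v : val v = VRoot -> degrees (net c) v = (0, 1).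
Proof.
move=> e; apply: (degreesE (l1 := [::]) (l2 := [:: child c 0])); rewrite ?e //.
  by move=> u; rewrite inE => /eqP->; apply: child_verts.
move=> u uv; rewrite inE; apply/idP/eqP => [|->]; last by rewrite vedge_child.
by case/(vedge_out cc uv) => [[[|p] lp []]|[p]|[i _ []]].
Qed.

Lemma vedge_leaf i u : u \in verts c -> vedge c (VLeaf i) u = false.
Proof.
by move=> uv; apply/negP; case/(vedge_out cc uv) => [[[|p] lp []]|[p]|[j _ []]].
Qed.

Lemma degrees_tip i v : i \in unused c -> val v = VLeaf i -> degrees (net c) v = (1, 0).
Proof.
move=> iu e; have := spot_leaf cc iu; rewrite mem_stale => /andP[sp _].
apply: (degreesE (l1 := [:: parent c (spot c (VLeaf i))]) (l2 := [::])); rewrite ?e //.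
- by move=> u; rewrite inE => /eqP->; apply: parent_verts.
- by move=> u uv; rewrite inE -vedge_child // child_leaf.
by move=> u uv; rewrite vedge_leaf.
Qed.

Lemma degrees_ret_leaf i v : i \notin unused c -> val v = VLeaf i ->
  degrees (net c) v = (1, 0).
Proof.
move=> iu e; apply: (degreesE (l1 := [:: VRet i]) (l2 := [::])); rewrite ?e //.
- by move=> u; rewrite inE => /eqP->; rewrite mem_verts.
- by move=> u uv; rewrite inE /= (negPf iu).
by move=> u uv; rewrite vedge_leaf.
Qed.

Lemma degrees_ret i v : val v = VRet i -> degrees (net c) v = (2, 1).
Proof.
move=> e; have iu : i \notin unused c by rewrite -(mem_verts c (VRet i)) -e val_verts.
have [p [lp lpp pp labE]] := used_labels iu.
apply: (degreesE (l1 := [:: VTree p; VTree (partner c p)]) (l2 := [:: VLeaf i])); rewrite ?e //.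
- by rewrite /= inE VTreeE eq_sym pp.
- by move=> u; rewrite !inE => /orP[]/eqP->; rewrite mem_verts label_fresh ?lp ?lpp.
- by move=> u; rewrite inE => /eqP->; rewrite mem_verts.
- by case=> [|j|j|q] uv; rewrite !inE //= labE !VTreeE.
move=> u uv; rewrite inE; apply/idP/eqP => [|->]; last by rewrite /= (negPf iu).
by case/(vedge_out cc uv) => [[[|q] lq []]|[q]|[j _ [[->] ->]]].
Qed.

(** A vertex has one backbone child after each of its occurrences as a letter: one if it is
    labelled, two if not. *)
Lemma parent_tree p q : p <= N.*2 -> fresh c q -> parent c p = VTree q ->
  p = q.+1 \/ label c q = None /\ p = (partner c q).+1.
Proof.
case: p => //= p lp fq [/eqP]; rewrite vx_eq // => /orP[/eqP->|/andP[/eqP-> /eqP->]].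
  by left.
by right.
Qed.

Lemma degrees_tree p v : val v = VTree p -> degrees (net c) v = (1, 2).
Proof.
move=> e; have fp : fresh c p by rewrite -(mem_verts c (VTree p)) -e val_verts.
have lp := fresh_lt fp.
have pE u : u \in verts c -> vedge c u (VTree p) = (u \in [:: parent c p]).
  by move=> uv; rewrite -(child_fresh fp) (vedge_child cc _ (ltnW lp)) inE.
have sub1 : {subset [:: parent c p] <= verts c}.
  by move=> u; rewrite inE => /eqP->; rewrite parent_verts // ltnW.
case lab : (label c p) => [i|].
  have iu : i \notin unused c.
    by apply/unusedPn; exists (Ordinal lp); rewrite -labelE.
  apply: (degreesE (l1 := [:: parent c p]) (l2 := [:: child c p.+1; VRet i])); rewrite ?e //.
  - by rewrite /= inE /child; case: ifP.
  - by move=> u; rewrite !inE => /orP[]/eqP->; rewrite ?child_verts // mem_verts.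
  move=> u uv; rewrite !inE; apply/idP/orP => [|[]/eqP->].
  - case/(vedge_out cc uv) => [[q lq [/esym/parent_tree-/(_ lq fp) pq ->]]|[q [<-] [j]]|[j _ []]] //.
      by case: pq => [->|[]]; [left|rewrite lab].
    by rewrite lab => -[->] ->; right.
  - by rewrite vedge_child //= vxE.
  by rewrite /= lab.
have pp := partner_lt c lp.
apply: (degreesE (l1 := [:: parent c p]) (l2 := [:: child c p.+1; child c (partner c p).+1]));
  rewrite ?e //.
- rewrite /= inE andbT; apply/eqP => /(child_inj cc lp pp) [pE'].
  by have := partner_neq cc lp; rewrite -pE' eqxx.
- by move=> u; rewrite !inE => /orP[]/eqP->; rewrite child_verts.
move=> u uv; rewrite !inE; apply/idP/orP => [|[]/eqP->].
- case/(vedge_out cc uv) => [[q lq [/esym/parent_tree-/(_ lq fp) pq ->]]|[q [<-] [j]]|[j _ []]] //.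
    by case: pq => [->|[_ ->]]; [left|right].
  by rewrite lab.
- by rewrite vedge_child //= vxE.
by rewrite vedge_child //= VTreeE eq_sym vx_eq // lab !eqxx orbT.
Qed.

Lemma is_leafE v : is_leaf (net c) v = if val v is VLeaf _ then true else false.
Proof.
rewrite /is_leaf; case e: (val v) => [|i|i|p].
- by rewrite degrees_root.
- by have [iu|iu] := boolP (i \in unused c); rewrite ?(degrees_tip iu) ?(degrees_ret_leaf iu).
- by rewrite (degrees_ret e).
by rewrite (degrees_tree e).
Qed.

Lemma is_retE v : is_ret (net c) v = if val v is VRet _ then true else false.
Proof.
rewrite /is_ret; case e: (val v) => [|i|i|p].
- by rewrite degrees_root.
- by have [iu|iu] := boolP (i \in unused c); rewrite ?(degrees_tip iu) ?(degrees_ret_leaf iu).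
- by rewrite (degrees_ret e).
by rewrite (degrees_tree e).
Qed.

Lemma is_treeE v : is_tree (net c) v = if val v is VTree _ then true else false.
Proof.
rewrite /is_tree; case e: (val v) => [|i|i|p].
- by rewrite degrees_root.
- by have [iu|iu] := boolP (i \in unused c); rewrite ?(degrees_tip iu) ?(degrees_ret_leaf iu).
- by rewrite (degrees_ret e).
by rewrite (degrees_tree e).
Qed.

(** A topological order: the parent letter before position [p] is a vertex of smaller position, and
    reticulations, then leaves, come after all positions. *)
Definition vrank (v : vtx N) : nat :=
  match v with
  | VRoot => 0
  | VTree p => p.+1
  | VRet _ => N.*2.+2
  | VLeaf _ => N.*2.+3
  end.

Lemma vrank_lt (u v : seq_sub (verts c)) : net_edge (net c) u v -> vrank (val u) < vrank (val v).
Proof.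
rewrite net_edgeE => /(vedge_out cc (val_verts v)) [[p lp [-> ->]]|[p -> [i lp ->]]|[i _ [-> ->]]] //=.
  rewrite /child; case: p lp => [|p] lp; first by case: ifP.
  by have := vx_le cc lp; case: ifP => /= _; lia.
by have := @label_lt _ c p; rewrite lp => /(_ isT); lia.
Qed.

Lemma net_acyclic : acyclic (net c).
Proof.
move=> v p; apply/negP => /= cyc.
have pl x q : path (net_edge (net c)) x q -> vrank (val x) <= vrank (val (last x q)).
  by elim: q x => //= y q IH x /andP[/vrank_lt /ltnW xy /IH]; apply: leq_trans.
by move: cyc; rewrite rcons_path => /andP[/pl h /vrank_lt]; rewrite ltnNge h.
Qed.

Lemma connect_root v : connect (net_edge (net c)) (net_root (net c)) v.
Proof.
have conn p w : p <= N.*2 -> val w = child c p ->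
    connect (net_edge (net c)) (net_root (net c)) w.
  elim/ltn_ind: p w => p IH w lp we.
  case: p IH lp we => [|p] IH lp we.
    by apply: connect1; rewrite net_edgeE we vedge_child.
  have vP : VTree (vx c p) \in verts c := parent_verts cc lp.
  have le := vx_le cc lp.
  apply: (connect_trans (IH (vx c p) _ (SeqSub vP) _ _)); rewrite ?ltnS ?(leq_trans le (ltnW lp)) //.
    by rewrite child_fresh ?vx_fresh.
  by apply: connect1; rewrite net_edgeE we vedge_child.
have ret w i : val w = VRet i -> connect (net_edge (net c)) (net_root (net c)) w.
  move=> we; have iu : i \notin unused c by rewrite -(mem_verts c (VRet i)) -we val_verts.
  have [p [lp _ _ _]] := used_labels iu.
  have fp : fresh c p by apply: label_fresh; rewrite lp.
  have tP : VTree p \in verts c by rewrite mem_verts.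
  apply: (connect_trans (y := SeqSub tP)).
    by apply: (conn p); [rewrite ltnW // (fresh_lt fp)|rewrite child_fresh].
  by apply: connect1; rewrite net_edgeE we /= lp.
have [e|[i iu [e|e]]|[p lp e]] := vertsP cc (val_verts v).
- by apply/eq_connect0/val_inj.
- exact: (ret _ i).
- have rP : VRet i \in verts c by rewrite mem_verts.
  apply: (connect_trans (ret (SeqSub rP) i erefl)); apply: connect1.
  by rewrite net_edgeE e /= (negPf iu).
exact: (conn p).
Qed.

Lemma net_valid : simplex_tree_child (net c).
Proof.
split.
- exact: net_acyclic.
- by split; [exact: degrees_root|exact: connect_root].
- split=> [i j|v]; first by rewrite !ffunE => -[].
  rewrite is_leafE; split=> [|[i <-]]; last by rewrite ffunE.
  case e: (val v) => [|i|i|p] // _; exists i; rewrite ffunE; exact: val_inj.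
- move=> v; rewrite is_leafE is_treeE is_retE; case e: (val v) => [|i|i|p] //.
  by case/eqP; apply: val_inj.
split=> [v|v w].
  have tl p : p <= N.*2 -> exists2 w : seq_sub (verts c), val w = child c p &
      is_tree (net c) w || is_leaf (net c) w.
    move=> lp; exists (SeqSub (child_verts c p)); rewrite // is_treeE is_leafE /=.
    by rewrite /child; case: ifP.
  rewrite is_leafE; case e: (val v) => [|i|i|p] // _.
  - have [w we wt] := tl 0 isT; exists w; rewrite // net_edgeE e we.
    by rewrite vedge_child.
  - have iu : i \notin unused c by rewrite -(mem_verts c (VRet i)) -e val_verts.
    exists (SeqSub (leaf_verts c i)); last by rewrite is_leafE orbT.
    by rewrite net_edgeE e /= (negPf iu).
  have fp : fresh c p by rewrite -(mem_verts c (VTree p)) -e val_verts.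
  have [|w we wt] := tl p.+1; first exact: fresh_lt fp.
  exists w; rewrite // net_edgeE e we vedge_child ?(fresh_lt fp) //=.
  by rewrite vxE.
rewrite is_retE is_leafE net_edgeE; case e: (val v) => [|i|i|p] // _.
by case/(vedge_out cc (val_verts w)) => [[[|q] lq []]|[q]|[j _ [_ ->]]].
Qed.

End NetValid.

(** * Distinct codes give non-isomorphic networks *)

Section CodeUnique.
Variable N : nat.
Implicit Types (c : pcode N) (p q : nat) (u v : vtx N).

Definition vtx_iso c c' (F : vtx N -> vtx N) : Prop :=
  [/\ forall v, v \in verts c -> F v \in verts c',
      F VRoot = VRoot, forall i, F (VLeaf i) = VLeaf i,
      forall u v, u \in verts c -> v \in verts c ->
        vedge c u v = vedge c' (F u) (F v) &
      forall u v, u \in verts c -> v \in verts c -> F u = F v -> u = v].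

Lemma index_stale c p : p \in stale c ->
  index p (stale c) = count (fun q => ~~ fresh c q) (iota 0 p).
Proof.
rewrite mem_stale => /andP[lp np].
have eI : iota 0 N.*2.+1 = iota 0 p ++ p :: iota p.+1 (N.*2 - p).
  by rewrite -(iotaD 0 p (N.*2 - p).+1); congr iota; lia.
rewrite /stale eI filter_cat index_cat mem_filter mem_iota ltnn andbF.
by rewrite /= np /= eqxx addn0 size_filter.
Qed.

(** The image of [VRet i] has two distinct parents, so it is a reticulation; it is the parent of the
    fixed leaf [i], so its label is [i]. *)
Lemma iso_ret c c' F i : c \in codes N -> c' \in codes N -> vtx_iso c c' F ->
  i \notin unused c -> i \notin unused c' /\ F (VRet i) = VRet i.
Proof.
move=> cc cc' [Fv F0 FL Fe Fi] iu.
have [p [lp lpp pp labE]] := used_labels cc iu.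
have rv : VRet i \in verts c by rewrite mem_verts.
have pv : VTree p \in verts c by rewrite mem_verts label_fresh ?lp.
have ppv : VTree (partner c p) \in verts c by rewrite mem_verts label_fresh ?lpp.
have e1 : vedge c' (F (VTree p)) (F (VRet i)) by rewrite -Fe //= lp.
have e2 : vedge c' (F (VTree (partner c p))) (F (VRet i)) by rewrite -Fe //= lpp.
have ne : F (VTree p) <> F (VTree (partner c p)).
  by move=> /(Fi _ _ pv ppv)[e]; rewrite -e eqxx in pp.
have e3 : vedge c' (F (VRet i)) (VLeaf i).
  by rewrite -FL -Fe // ?mem_verts //= (negPf iu) eqxx.
have [E|[j ju [E|E]]|[q lq E]] := vertsP cc' (Fv _ rv).
- by rewrite E in e1.
- move: e3; rewrite E /=; case: ifPn => [_|iu' /eqP[<-]] //.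
  by case: nth.
- by move: e1 e2; rewrite E /= (negPf ju) => /eqP e1' /eqP e2'; case: ne; rewrite e1'.
by move: e1 e2; rewrite E !vedge_child // => /eqP e1' /eqP e2'; case: ne; rewrite e1'.
Qed.

(** [a] is where the path being read at [p] ends; it exists because [N.*2] is always stale. *)
Lemma next_stale c p : p <= N.*2 ->
  exists a, [/\ p <= a, a \in stale c & forall q, p <= q -> q < a -> fresh c q].
Proof.
move=> lp; have ex : exists a, (p <= a) && (a \in stale c).
  by exists N.*2; rewrite lp mem_stale leqnn /fresh ltnn.
exists (ex_minn ex); case: ex_minnP => a /andP[pa ast] amin; split=> // q pq qa.
apply: contraT => nf; have := amin q; rewrite pq mem_stale nf andbT.
move: ast; rewrite mem_stale => /andP[aP _] /(_ (leq_trans (ltnW qa) aP)).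
by rewrite leqNgt qa.
Qed.

Lemma child_stale c p : p \in stale c -> child c p = VLeaf (tip c p).
Proof. by rewrite mem_stale /child => /andP[_ /negPf->]. Qed.

Section Step.
Variables (c c' : pcode N) (F : vtx N -> vtx N).
Hypotheses (cc : c \in codes N) (cc' : c' \in codes N) (iF : vtx_iso c c' F)
  (uE : unused c = unused c').
Variables (p a a' : nat).
Hypotheses (ast : a \in stale c) (ast' : a' \in stale c')
  (fra : forall q, p <= q -> q < a -> fresh c q)
  (fra' : forall q, p <= q -> q < a' -> fresh c' q)
  (IH : forall q, q < p -> F (child c q) = child c' q).

Lemma step_fresh q : q < p -> p <= N.*2 -> fresh c q = fresh c' q.
Proof.
have [Fv F0 FL Fe Fi] := iF; move=> qp lp; have := IH qp; rewrite /child.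
case: ifP => fq; case: ifP => fq' //; last by rewrite FL.
by rewrite -FL => /Fi; rewrite !mem_verts fq => /(_ isT isT).
Qed.

(* The leaves [child c a] and [child c' a'] are both the first leaf that is
   not among the first [p] vertices; going up from it in both networks, one
   meets the first [p] vertices after the same number of steps. *)
Lemma step_child : p <= a -> a <= a' -> F (child c p) = child c' p.
Proof.
have [Fv F0 FL Fe Fi] := iF; move=> pa aa'.
have pa' : p <= a' := leq_trans pa aa'.
have [aP aP'] : a <= N.*2 /\ a' <= N.*2.
  by move: ast ast'; rewrite !mem_stale => /andP[-> _] /andP[-> _].
have pP := leq_trans pa aP.
have cnt (d : pcode N) b (fb : forall q, p <= q -> q < b -> fresh d q) : p <= b ->
    count (fun q => ~~ fresh d q) (iota 0 b) = count (fun q => ~~ fresh d q) (iota 0 p).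
  move=> pb; rewrite -(subnKC pb) iotaD count_cat add0n.
  rewrite [X in _ + X](_ : _ = 0) ?addn0 //; apply/eqP; rewrite -leqn0 leqNgt -has_count.
  by apply/hasPn => q; rewrite mem_iota => /andP[pq qb]; rewrite negbK fb // -(subnKC pb).
have tE : tip c a = tip c' a'.
  rewrite /tip !index_stale // (cnt _ _ fra pa) (cnt _ _ fra' pa') /tips uE.
  congr nth; apply: eq_in_count => q; rewrite mem_iota => /andP[_ qp].
  by rewrite step_fresh.
have up d : d <= a - p -> F (child c (a - d)) = child c' (a' - d).
  elim: d => [_|d IHd dp]; first by rewrite !subn0 !child_stale // FL tE.
  have {IHd} := IHd (ltnW dp).
  have -> : a - d = (a - d.+1).+1 by lia.
  have -> : a' - d = (a' - d.+1).+1 by lia.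
  have fa : fresh c (a - d.+1) by apply: fra; lia.
  have fa' : fresh c' (a' - d.+1) by apply: fra'; lia.
  move=> e; have := vedge_child cc (parent c (a - d.+1).+1) (p := (a - d.+1).+1).
  rewrite eqxx Fe ?parent_verts ?child_verts //; try by lia.
  rewrite e vedge_child //; last by lia.
  move=> /(_ _)/eqP; rewrite /= !vxE // !child_fresh //; apply; lia.
have := up (a - p) (leqnn _); rewrite subKn //.
have -> : a' - (a - p) = p + (a' - a) by lia.
case: (a' - a) (subnKC aa') => [|d] dE; first by rewrite addn0.
(* If [a < a'], the image of [child c p] hangs from position [p + d] of the second word, whereas its
   parent in [c] is the root or one of the first [p] vertices, which [IH] sends to a position below
   [p]. *)
rewrite addnS => e; exfalso.
have fr : fresh c' (p + d) by apply: fra'; lia.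
have rP : (p + d).+1 <= N.*2 by lia.
have := vedge_child cc (parent c p) pP; rewrite eqxx.
rewrite Fe ?parent_verts ?child_verts // e vedge_child // /= vxE // => /eqP.
move=> pE.
have [p0|[p' pp]] : p = 0 \/ exists p', p = p'.+1 by case: (p) => [|p']; [left|right; exists p'].
  by move: pE; rewrite {1}p0 /= F0.
have pP' : p' < N.*2 by rewrite -pp.
have le := vx_le cc pP'.
move: pE; rewrite {1}pp /= -(child_fresh (vx_fresh cc pP')) IH ?pp ?ltnS // -pp.
rewrite -(child_fresh fr) => /(child_inj cc'); lia.
Qed.

End Step.

(** [step_child] needs the first path to be no longer than the second; in the other case it is
    applied to the inverse [G]. Once positions are preserved, labels are read off the edges into
    reticulations. Partners come from the letter at a stale position, or from the label if there is
    one. *)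
Lemma code_unique c c' F G : c \in codes N -> c' \in codes N ->
  vtx_iso c c' F -> vtx_iso c' c G ->
  (forall v, v \in verts c -> G (F v) = v) ->
  (forall v, v \in verts c' -> F (G v) = v) -> c = c'.
Proof.
move=> cc cc' iF iG GF FG.
have uE : unused c = unused c'.
  apply/setP => i; apply/idP/idP; apply: contraLR => iu.
    by have [] := iso_ret cc' cc iG iu.
  by have [] := iso_ret cc cc' iF iu.
have chE p : p <= N.*2 -> F (child c p) = child c' p.
  elim/ltn_ind: p => p IH lp.
  have IHF q : q < p -> F (child c q) = child c' q.
    by move=> qp; rewrite IH // (leq_trans (ltnW qp)).
  have IHG q : q < p -> G (child c' q) = child c q.
    by move=> qp; rewrite -IHF // GF // child_verts.
  have [a [pa ast fra]] := next_stale c lp.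
  have [a' [pa' ast' fra']] := next_stale c' lp.
  case: (leqP a a') => aa'.
    exact: (step_child cc cc' iF uE ast ast' fra fra').
  rewrite -[RHS]FG ?child_verts //; congr F; apply/esym.
  exact: (step_child cc' cc iG (esym uE) ast' ast fra' fra IHG pa' (ltnW aa')).
have [Fv F0 FL Fe Fi] := iF.
have frE p : fresh c p = fresh c' p.
  case: (ltnP p N.*2) => lp; last by rewrite /fresh !ltnNge lp.
  apply: (step_fresh iF (p := p.+1)) => // q qp.
  by rewrite chE // (leq_trans (ltnW qp)).
have FT p : fresh c p -> F (VTree p) = VTree p.
  by move=> fp; rewrite -{1}(child_fresh fp) chE ?child_fresh -?frE // ltnW // (fresh_lt fp).
have vxe p : p < N.*2 -> vx c p = vx c' p.
  move=> lp; have := vedge_child cc (parent c p.+1) lp.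
  rewrite eqxx Fe ?parent_verts ?child_verts // chE // vedge_child //= FT ?vx_fresh //.
  by move=> /eqP[].
have labE p : label c p = label c' p.
  have [fp|nf] := boolP (fresh c p); last first.
    have lN (d : pcode N) : ~~ fresh d p -> label d p = None.
      by apply: contraNeq => l; apply: label_fresh; case: label l.
    by rewrite !lN // -frE.
  have sub i : i \notin unused c -> (label c p == Some i) = (label c' p == Some i).
    move=> iu; have [_ Fr] := iso_ret cc cc' iF iu.
    have := Fe (VTree p) (VRet i); rewrite FT // Fr !mem_verts; exact.
  have lu (d : pcode N) i : label d p = Some i -> i \notin unused d.
    move=> l; apply/unusedPn; have lp : p < N.*2 by apply: (@label_lt _ d); rewrite l.
    by exists (Ordinal lp); rewrite -labelE.
  case e: (label c p) => [i|]; first by apply/esym/eqP; rewrite -sub ?e // (lu c).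
  case e': (label c' p) => [i|] //.
  by have := sub i; rewrite uE (lu c') // e e' eqxx => /(_ isT).
have ptE p : p < N.*2 -> partner c p = partner c' p.
  move=> lp; have stE q : q < N.*2 -> ~~ fresh c q -> partner c q = partner c' q.
    by move=> lq nq; have := vxe q lq; rewrite /vx -frE (negPf nq).
  have [fp|np] := boolP (fresh c p); last exact: stE.
  case lab: (label c p) => [i|].
    have l' : label c' p by rewrite -labE lab.
    have [||//] := label_inj cc' l' (q := partner c p).
      by rewrite -!labE label_partner.
    by move=> e; have := partner_neq cc lp; rewrite e eqxx.
  have np : ~~ fresh c (partner c p).
    move: fp; rewrite /fresh /labelled label_partner // lab partnerK //= partner_lt //.
    by rewrite lp -leqNgt => /ltnW.
  rewrite -[p in RHS](partnerK p cc) (stE (partner c p)) ?partner_lt //.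
  by rewrite partnerK.
apply/ffunP => p; rewrite [LHS]surjective_pairing [RHS]surjective_pairing.
congr (_, _); last by have := labE p; rewrite !labelE.
by apply: val_inj; have := ptE p (ltn_ord p); rewrite !partnerE.
Qed.

Lemma net_inj c c' : c \in codes N -> c' \in codes N ->
  network_iso (net c) (net c') -> c = c'.
Proof.
move=> cc cc' [f [[g fK gK] f0 fe fl]].
pose F v := val (f (insubd (SeqSub (root_verts c)) v)).
pose G v := val (g (insubd (SeqSub (root_verts c')) v)).
have g0 : g (net_root (net c')) = net_root (net c) by rewrite -f0 fK.
have ge (u v : seq_sub (verts c')) : net_edge (net c') u v = net_edge (net c) (g u) (g v) by rewrite fe !gK.
have gl i : g (net_label (net c') i) = net_label (net c) i by rewrite -fl fK.
have insL (d : pcode N) i x : insubd x (VLeaf i) = net_label (net d) i :> seq_sub (verts d).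
  by apply: val_inj; rewrite val_insubd ffunE leaf_verts.
have insR (d : pcode N) x : insubd x VRoot = net_root (net d) :> seq_sub (verts d).
  by apply: val_inj; rewrite val_insubd root_verts.
have isoH (d d' : pcode N) (h : seq_sub (verts d) -> seq_sub (verts d')) (x : seq_sub (verts d)) : injective h ->
    h (net_root (net d)) = net_root (net d') ->
    (forall u v : seq_sub (verts d), net_edge (net d) u v = net_edge (net d') (h u) (h v)) ->
    (forall i, h (net_label (net d) i) = net_label (net d') i) ->
    vtx_iso d d' (fun v => val (h (insubd x v))).
  move=> hi h0 he hl; split.
  - by move=> v _; apply: val_verts.
  - by rewrite insR h0.
  - by move=> i; rewrite insL hl ffunE.
  - move=> u v uv vv.
    by have := he (insubd x u) (insubd x v); rewrite !net_edgeE !val_insubd uv vv.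
  move=> u v uv vv /val_inj/hi/(congr1 val).
  by rewrite !val_insubd uv vv.
apply: (@code_unique c c' F G) => //.
- exact: isoH (can_inj fK) f0 fe fl.
- exact: isoH (can_inj gK) g0 ge gl.
- by move=> v vv; rewrite /G /F valKd fK val_insubd vv.
by move=> v vv; rewrite /G /F valKd gK val_insubd vv.
Qed.

End CodeUnique.

(** * Every network has a code *)

Section NetworkFacts.
Variables (X V : finType) (M : network X V).
Hypothesis valid : simplex_tree_child M.
Local Notation e := (net_edge M).
Local Notation o := (net_root M).
Local Notation lab := (net_label M).

Let hA : acyclic M. Proof. by case: valid. Qed.
Let hR : degrees M o = (0, 1). Proof. by case: valid => _ []. Qed.
Let hC v : connect e o v. Proof. by case: valid => _ []. Qed.
Let hLi : injective lab. Proof. by case: valid => _ _ []. Qed.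
Let hL v : is_leaf M v <-> exists x, lab x = v. Proof. by case: valid => _ _ []. Qed.
Let hV v : v != o -> [|| is_leaf M v, is_tree M v | is_ret M v].
Proof. by case: valid => _ _ _ h _; apply: h. Qed.
Let hTC : tree_child M. Proof. by case: valid => _ _ _ _ []. Qed.
Let hOC : one_component M. Proof. by case: valid => _ _ _ _ []. Qed.

Lemma leaf_lab x : is_leaf M (lab x). Proof. by apply/hL; exists x. Qed.

Lemma card_pred0 (P : pred V) : #|P| = 0 -> P =1 xpred0.
Proof. by move=> /card0_eq h x; have := h x. Qed.

Lemma card_pred1 (P : pred V) : #|P| = 1 -> exists x, forall y, P y = (y == x).
Proof. by move=> /mem_card1[x h]; exists x => y; have := h y. Qed.

Lemma card_pred2 (P : pred V) : #|P| = 2 ->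
  exists x y, x != y /\ forall z, P z = (z == x) || (z == y).
Proof.
move=> h; have /cards2P[x [y [xy E]]] : #|[set z | P z]%SET| == 2 by rewrite cardsE h.
by exists x, y; split=> // z; have := congr1 (fun A : {set V} => z \in A) E; rewrite !inE.
Qed.

Lemma no_in_root u : e u o = false.
Proof. by have [/card_pred0/(_ u)] := hR. Qed.

Lemma root_child : exists2 x, (is_tree M x || is_leaf M x) & forall y, e o y = (y == x).
Proof.
have [_ /card_pred1[x h]] := hR; exists x => //.
have [|y] := hTC (v := o); first by rewrite /is_leaf hR.
by have := h y; rewrite /= => -> /eqP->.
Qed.

Lemma no_out_leaf v w : is_leaf M v -> e v w = false.
Proof. by move=> /eqP[_ /card_pred0/(_ w)]. Qed.

Lemma tree_not_leaf v : is_tree M v -> is_leaf M v = false.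
Proof. by rewrite /is_tree /is_leaf => /eqP->. Qed.

Lemma ret_not_leaf v : is_ret M v -> is_leaf M v = false.
Proof. by rewrite /is_ret /is_leaf => /eqP->. Qed.

Lemma ret_not_tree v : is_ret M v -> is_tree M v = false.
Proof. by rewrite /is_ret /is_tree => /eqP->. Qed.

Lemma root_not_tree : is_tree M o = false. Proof. by rewrite /is_tree hR. Qed.
Lemma root_not_leaf : is_leaf M o = false. Proof. by rewrite /is_leaf hR. Qed.
Lemma root_not_ret : is_ret M o = false. Proof. by rewrite /is_ret hR. Qed.

Definition par (v : V) : V := odflt o [pick u | e u v].

Lemma parE v u : is_tree M v || is_leaf M v -> e u v = (u == par v).
Proof.
move=> tl; have [x h] : exists x, forall y, e y v = (y == x).
  by case/orP: tl => /eqP[/card_pred1].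
rewrite h /par; case: pickP => [y|/(_ x)]; first by rewrite h => /eqP->.
by rewrite h eqxx.
Qed.

Lemma retP r : is_ret M r -> exists v1 v2 x, [/\ v1 != v2,
  forall u, e u r = (u == v1) || (u == v2) & forall w, e r w = (w == lab x)].
Proof.
move=> rr; have /eqP[/card_pred2[v1 [v2 [v12 h]]] /card_pred1[l h']] := rr.
have : is_leaf M l by apply: hOC rr _; rewrite [e r l]h'.
by move=> /hL[x xl]; exists v1, v2, x; split=> //; rewrite xl.
Qed.

Lemma ret_parent r u : is_ret M r -> e u r -> is_tree M u.
Proof.
move=> rr ur; have uo : u != o.
  apply/eqP => uo; have [x xt xE] := root_child; move: ur; rewrite uo xE => /eqP rx.
  by move: xt; rewrite -rx ret_not_tree ?ret_not_leaf.
case/or3P: (hV uo) => // [ul|ru]; first by rewrite no_out_leaf in ur.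
by have := hOC ru ur; rewrite ret_not_leaf.
Qed.

Lemma tree_children v : is_tree M v -> exists c1 c2, [/\ c1 != c2,
  forall w, e v w = (w == c1) || (w == c2) & is_tree M c1 || is_leaf M c1].
Proof.
move=> tv; have /eqP[_ /card_pred2[x [y [xy h]]]] := tv.
have [|z] := hTC (v := v); first by rewrite tree_not_leaf.
rewrite [e v z]h => /orP[]/eqP-> zt; [exists x, y|exists y, x]; split=> //.
  by rewrite eq_sym.
by move=> w; rewrite orbC -[RHS]h.
Qed.

(* The backbone: what remains, apart from the root, when the reticulations and
   their leaves are removed. *)
Definition bb (v : V) : bool := is_tree M v || is_leaf M v && ~~ is_ret M (par v).

Lemma bb_tl v : bb v -> is_tree M v || is_leaf M v.
Proof. by case/orP=> [->//|/andP[->]]; rewrite orbT. Qed.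

Lemma bb_par v : bb v -> par v = o \/ is_tree M (par v).
Proof.
move=> bv; have pv : e (par v) v by rewrite parE ?bb_tl.
have [|po] := eqVneq (par v) o; [by left|right].
case/or3P: (hV po) => // [lp|rp]; first by rewrite no_out_leaf in pv.
case/orP: bv => [tv|/andP[_]]; last by rewrite rp.
by have := hOC rp pv; rewrite tree_not_leaf.
Qed.

Lemma bb_child v w : is_tree M v || (v == o) -> e v w -> is_tree M w || is_leaf M w -> bb w.
Proof.
move=> tv vw tl; rewrite /bb; case/orP: (tl) => [->//|lw]; rewrite lw /=.
move: vw; rewrite parE // => /eqP<-; apply/orP; right; apply/negP => rv.
by case/orP: tv => [|/eqP vo]; [rewrite ret_not_tree|rewrite vo root_not_ret in rv].
Qed.

Lemma bb_root : bb o = false. Proof. by rewrite /bb root_not_tree root_not_leaf. Qed.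

Lemma connect_rootE u : connect e u o -> u = o.
Proof.
case/connectP => p; case/lastP: p => // p z; rewrite rcons_path last_rcons.
by move=> /andP[_ h] zo; rewrite -zo no_in_root in h.
Qed.

Lemma connect_leaf u w : is_leaf M u -> connect e u w -> w = u.
Proof.
by move=> lu /connectP[[|z p]] //= /andP[]; rewrite no_out_leaf.
Qed.

Lemma no_back u v : e u v -> connect e v u = false.
Proof.
move=> uv; apply/negP => /connectP[p pp pu].
by have := hA v p; rewrite /= rcons_path pp -pu uv.
Qed.

(** The only proper descendant of a reticulation is its leaf, which is not in the backbone. *)
Lemma bb_anc l w : bb l -> is_leaf M l -> connect e w l -> w != o -> bb w.
Proof.
move=> bl ll wl wo; case/or3P: (hV wo) => [lw|tw|rw].
- by rewrite -(connect_leaf lw wl).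
- by rewrite /bb tw.
exfalso; have [v1 [v2 [x [_ _ h]]]] := retP rw.
case/connectP: wl => [[|z p]] /=.
  by move=> _ lw; rewrite lw ret_not_leaf in ll.
rewrite h => /andP[/eqP-> pp lE].
have lE' : l = lab x by apply: (connect_leaf (leaf_lab x)); apply/connectP; exists p.
have : e w l by rewrite h lE'.
rewrite parE ?bb_tl // => /eqP pl; move: bl; rewrite /bb -pl rw andbF orbF => tl.
by rewrite tree_not_leaf in ll.
Qed.

(** The tree-child property lets one descend inside the backbone, and acyclicity makes the reachable
    set shrink strictly, so a leaf is met. Hence an enumeration that contains all backbone leaves
    and is closed under ancestors is complete. *)
Lemma bb_leaf v : bb v -> exists x, bb (lab x) /\ connect e v (lab x).
Proof.
have [n le] := ubnP #|[pred w | connect e v w]|.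
elim: n v le => // n IH v le bv.
have [tv|ntv] := boolP (is_tree M v); last first.
  have lv : is_leaf M v by move: bv; rewrite /bb (negPf ntv) => /andP[].
  by have /hL[x xv] := lv; exists x; rewrite xv.
have [c1 [c2 [_ h t1]]] := tree_children tv.
have vc : e v c1 by rewrite h eqxx.
have [||x [bx cx]] := IH c1; last 1 first.
- by exists x; split=> //; apply: connect_trans (connect1 vc) cx.
- rewrite -ltnS; apply: leq_trans le; rewrite ltnS; apply: proper_card; apply/properP; split.
    by apply/fintype.subsetP => w; rewrite !inE => /(connect_trans (connect1 vc)).
  by exists v; rewrite !inE ?connect0 // no_back.
by apply: bb_child vc t1; rewrite tv.
Qed.

(** Sorted by label like [tips], so that the k-th path of the enumeration ends in the leaf that the
    code puts there. *)
Definition tip_leaves : seq V := [seq lab x | x <- enum [set x | bb (lab x)]%SET].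

Definition next_leaf (t : seq V) : V := nth o tip_leaves (count (is_leaf M) t).

(* [run t] says that [rev t] lists, in this order, the first vertices of the
   greedy enumeration of the backbone: go down from the root to the first leaf,
   then from the vertices already listed to the second leaf, and so on. *)
Inductive run : seq V -> Prop :=
  | run_nil : run [::]
  | run_cons x t : run t -> count (is_leaf M) t < size tip_leaves ->
      x \notin t -> bb x -> par x \in o :: t -> connect e x (next_leaf t) ->
      (is_tree M (head o t) -> par x = head o t) -> run (x :: t).

Lemma run_bb t : run t -> all bb t.
Proof. by elim=> //= x {}t _ -> _ _ ->. Qed.

Lemma run_uniq t : run t -> uniq t.
Proof. by elim=> //= x {}t _ -> _ ->. Qed.

Lemma next_leaf_in t : count (is_leaf M) t < size tip_leaves ->
  next_leaf t \in tip_leaves.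
Proof. by move=> h; apply: mem_nth. Qed.

Lemma tip_leavesP v : reflect (bb v /\ is_leaf M v) (v \in tip_leaves).
Proof.
apply: (iffP mapP) => [[x + ->]|[bv /hL[x xv]]]; first by rewrite mem_enum inE leaf_lab.
by exists x; rewrite // mem_enum inE xv.
Qed.

Lemma run_leaves t : run t ->
  [seq v <- rev t | is_leaf M v] = take (count (is_leaf M) t) tip_leaves.
Proof.
elim=> [|x {}t _ IH lt xt bx _ xl _]; first by rewrite take0.
rewrite rev_cons filter_rcons IH /=; case: ifP => lx; last by rewrite add0n.
rewrite add1n (take_nth o) //; congr rcons.
by rewrite -(connect_leaf lx xl).
Qed.

Lemma run_closed t u w : run t -> w \in t -> connect e u w -> u \in o :: t.
Proof.
move=> rt wt /connectP[p pp wE]; subst w.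
have cl v : v \in t -> par v \in o :: t.
  elim: rt => // x s _ IH _ _ _ px _ _; rewrite !(inE, in_cons) => /orP[/eqP->|/IH].
    by move: px; rewrite inE => /orP[->|->]; rewrite ?orbT.
  by rewrite inE => /orP[->|->]; rewrite ?orbT.
elim/last_ind: p pp wt => [_ /= ut|p z IH]; first by rewrite inE ut orbT.
rewrite rcons_path last_rcons => /andP[pp ez] zt.
have bz : bb z by apply: (allP (run_bb rt)).
have := cl z zt; move: ez; rewrite parE ?bb_tl // => /eqP<-; rewrite inE => /orP[/eqP eo|].
  by rewrite [u]connect_rootE ?mem_head //; apply/connectP; exists p.
exact: IH.
Qed.

Lemma run_step t : run t -> count (is_leaf M) t < size tip_leaves ->
  exists x, run (x :: t).
Proof.
move=> rt lt; have /tip_leavesP[bl ll] := next_leaf_in lt.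
set l := next_leaf t in bl ll.
have lnt : l \notin t.
  apply/negP => lt'; have : l \in [seq v <- rev t | is_leaf M v].
    by rewrite mem_filter ll mem_rev.
  rewrite run_leaves //; apply/negP.
  have u : uniq tip_leaves by rewrite map_inj_uniq // enum_uniq.
  by move: u; rewrite -{1}(cat_take_drop (count (is_leaf M) t) tip_leaves) (drop_nth o lt)
    cat_uniq /= negb_or -/l => /and3P[_ /andP[]].
have [th|hN] := boolP (is_tree M (head o t)).
  case: t rt lt @l lnt bl ll th => [|v t] rt lt l lnt bl ll /= tv.
    by rewrite root_not_tree in tv.
  have [rt' vt vl] : [/\ run t, v \notin t & connect e v l].
    by inversion rt; split=> //; rewrite /l /next_leaf /= tree_not_leaf.
  case/connectP: vl => [[|y p]] /=; first by move=> _ lv; rewrite lv tree_not_leaf in ll.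
  move=> /andP[vy pp] lE; have yl : connect e y l by apply/connectP; exists p.
  have by_ : bb y.
    by apply: (bb_anc bl ll yl); apply/eqP => yo; rewrite yo no_in_root in vy.
  have py : v = par y by apply/eqP; rewrite -parE ?bb_tl.
  exists y; apply: run_cons => //.
  - rewrite inE negb_or; apply/andP; split.
      by apply/eqP => yv; have := no_back vy; rewrite yv connect0.
    apply/negP => yt; have := run_closed rt' yt (connect1 vy).
    by rewrite inE (negPf vt) orbF => /eqP vo; rewrite vo root_not_tree in tv.
  - by rewrite -py !inE eqxx orbT.
have first_out (S : pred V) a p : path e a p -> S a -> ~~ S (last a p) ->
    exists u x, [/\ S u, ~~ S x, e u x & connect e x (last a p)].
  elim: p a => [|b p IH] a /=; first by move=> _ ->.
  move=> /andP[ab pp] Sa nl; have [Sb|nb] := boolP (S b); first exact: IH.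
  by exists a, b; split=> //; apply/connectP; exists p.
have /connectP[p pp lE] := hC l.
have [||u [x []]] := first_out (mem (o :: t)) o p pp; rewrite -?lE.
- by rewrite /= mem_head.
- rewrite /= inE negb_or lnt andbT; apply/eqP => lo; by rewrite lo root_not_leaf in ll.
rewrite /= => ut; rewrite inE negb_or => /andP[xo xt] ux xl.
have bx : bb x by apply: (bb_anc bl ll xl).
exists x; apply: run_cons => //; last by rewrite (negPf hN).
by move: ux; rewrite parE ?bb_tl // => /eqP<-.
Qed.

Lemma run_full : exists2 t, run t & count (is_leaf M) t = size tip_leaves.
Proof.
have cl t : run t -> count (is_leaf M) t <= size tip_leaves.
  by elim=> //= x {}t _ _ lt _ _ _ _ _; apply: leq_trans lt; rewrite -add1n leq_add2r leq_b1.
have sz t : run t -> size t <= #|V|.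
  by move=> rt; rewrite -(card_uniqP (run_uniq rt)) max_card.
suff ext n t : run t -> #|V| - size t <= n ->
    exists2 t, run t & count (is_leaf M) t = size tip_leaves.
  exact: (ext #|V| [::] run_nil (leq_subr _ _)).
elim: n t => [|n IH] t rt le; have := cl t rt;
  rewrite leq_eqVlt => /orP[/eqP ce|lt]; try by exists t.
- by exfalso; have [x rx] := run_step rt lt; move: (sz _ rx) le => /=; lia.
have [x rx] := run_step rt lt; apply: (IH _ rx).
by move: (sz _ rx) le => /=; lia.
Qed.

Lemma backbone_enum : exists s, [/\ uniq s, s =i bb,
  [seq v <- s | is_leaf M v] = tip_leaves,
  forall p, p.+1 < size s -> is_tree M (nth o s p) ->
    par (nth o s p.+1) = nth o s p &
  forall p, p < size s -> par (nth o s p) = o \/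
    exists2 q, q < p & par (nth o s p) = nth o s q].
Proof.
have [t rt ct] := run_full; exists (rev t).
have lE : [seq v <- rev t | is_leaf M v] = tip_leaves.
  by rewrite run_leaves // ct take_size.
split=> //.
- by rewrite rev_uniq run_uniq.
- move=> v; rewrite mem_rev; apply/idP/idP => [|bv]; first exact: (allP (run_bb rt)).
  have [x [bx cx]] := bb_leaf bv.
  have : lab x \in [seq v <- rev t | is_leaf M v].
    by rewrite lE; apply/tip_leavesP; split; rewrite ?leaf_lab.
  rewrite mem_filter mem_rev => /andP[_ xt]; have := run_closed rt xt cx.
  rewrite inE => /orP[/eqP vo|//].
  by have : bb v := bv; rewrite vo bb_root.
- elim: rt {ct lE} => // x s rs IH _ _ _ _ _ hx p; rewrite rev_cons size_rcons ltnS => lp.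
  rewrite !nth_rcons lp; case: ltnP => ls; first exact: IH.
  have -> : (p.+1 == size (rev s)) by rewrite eqn_leq lp.
  have -> : nth o (rev s) p = head o s.
    rewrite size_rev in lp ls; rewrite nth_rev // -nth0; congr nth; lia.
  exact: hx.
elim: rt {ct lE} => // x s rs IH _ _ _ px _ _ p; rewrite rev_cons size_rcons ltnS => lp.
rewrite nth_rcons; case: ltnP => ls.
  have [->|[q qp ->]] := IH _ ls; [by left|right; exists q => //].
  by rewrite nth_rcons (ltn_trans qp ls).
have -> : (p == size (rev s)) by rewrite eqn_leq lp.
move: px; rewrite inE => /orP[/eqP->|ps]; [by left|right].
exists (index (par x) (rev s)).
  by apply: leq_trans ls; rewrite index_mem mem_rev.
by rewrite nth_rcons index_mem mem_rev ps nth_index // mem_rev.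
Qed.

Lemma card_bb : #|[pred v | bb v]|.+1 = 2 * #|X|.
Proof.
pose b2n (b : bool) : nat := b.
have inE_ v : \sum_u b2n (e u v) = b2n (is_leaf M v) + b2n (is_tree M v) + 2 * b2n (is_ret M v).
  transitivity (degrees M v).1.
    by rewrite /= -sum1_card [RHS]big_mkcond; apply: eq_bigr => u _; rewrite inE; case: (e u v).
  have [->|vo] := eqVneq v o; first by rewrite root_not_leaf root_not_tree root_not_ret hR.
  by case/or3P: (hV vo) => h; have /eqP-> := h; rewrite /is_leaf /is_tree /is_ret; have /eqP-> := h.
have outE_ v : \sum_w b2n (e v w) = b2n (v == o) + 2 * b2n (is_tree M v) + b2n (is_ret M v).
  transitivity (degrees M v).2.
    by rewrite /= -sum1_card [RHS]big_mkcond; apply: eq_bigr => u _; rewrite inE; case: (e v u).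
  have [->|vo] := eqVneq v o; first by rewrite root_not_tree root_not_ret hR.
  by case/or3P: (hV vo) => h; have /eqP-> := h; rewrite /is_leaf /is_tree /is_ret; have /eqP-> := h.
have cardE_ (P : pred V) : #|P| = \sum_v b2n (P v).
  by rewrite -sum1_card big_mkcond; apply: eq_bigr => v _; rewrite unfold_in; case: (P v).
have e1 : #|is_leaf M| + #|is_tree M| + 2 * #|is_ret M| = #|pred1 o| + 2 * #|is_tree M| + #|is_ret M|.
  rewrite !cardE_ !big_distrr -!big_split /=.
  transitivity (\sum_v \sum_u b2n (e u v)); first by apply: eq_bigr => v _; rewrite inE_.
  by rewrite exchange_big; apply: eq_bigr => v _; rewrite outE_.
have e2 : #|is_leaf M| = #|X|.
  rewrite -(card_codom hLi); apply: eq_card => v.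
  by apply/idP/codomP => [/hL[x <-]|[x ->]]; [exists x|apply: leaf_lab].
have e3 : #|[pred v | is_leaf M v & is_ret M (par v)]| = #|is_ret M|.
  rewrite -(card_in_image (f := par) (A := [pred v | is_leaf M v & is_ret M (par v)])); last first.
    move=> u v; rewrite !inE => /andP[lu ru] /andP[lv _] uv.
    have [v1 [v2 [x [_ _ h]]]] := retP ru.
    have : e (par u) u by rewrite parE ?lu ?orbT.
    have : e (par u) v by rewrite uv parE ?lv ?orbT.
    by rewrite !h => /eqP-> /eqP->.
  apply: eq_card => r; apply/fintype.imageP/idP => [[v]|rr]; first by rewrite inE => /andP[_ rv] ->.
  have [v1 [v2 [x [_ _ h]]]] := retP rr.
  have pr : r = par (lab x) by apply/eqP; rewrite -parE ?leaf_lab ?orbT // h.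
  by exists (lab x); rewrite // inE leaf_lab -pr.
have e4 : #|[pred v | bb v]| + #|[pred v | is_leaf M v & is_ret M (par v)]| =
    #|is_tree M| + #|is_leaf M|.
  rewrite !cardE_ -!big_split /=; apply: eq_bigr => v _; rewrite /bb.
  have [tv|] := boolP (is_tree M v); first by rewrite tree_not_leaf.
  by move=> _; case: (is_leaf M v) => //=; case: (is_ret M (par v)).
by move: e1 e2 e3 e4; rewrite card1; lia.
Qed.

End NetworkFacts.

Section NetworkCode.
Variables (N : nat) (V : finType) (M : network 'I_N.+1 V).
Hypothesis valid : simplex_tree_child M.
Local Notation e := (net_edge M).
Local Notation o := (net_root M).
Local Notation lab := (net_label M).
Local Notation par := (par M).
Local Notation bb := (bb M).

Variable s : seq V.
Hypotheses (us : uniq s) (sb : s =i bb)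
  (sl : [seq v <- s | is_leaf M v] = tip_leaves M)
  (s_tree : forall p, p.+1 < size s -> is_tree M (nth o s p) ->
     par (nth o s p.+1) = nth o s p)
  (s_par : forall p, p < size s -> par (nth o s p) = o \/
     exists2 q, q < p & par (nth o s p) = nth o s q).

Let size_s : size s = N.*2.+1.
Proof.
have := card_bb valid; rewrite card_ord -(card_uniqP us).
have -> : #|[pred v | bb v]| = #|s| by apply: eq_card => v; rewrite sb.
by lia.
Qed.

Let bbs p : p <= N.*2 -> bb (nth o s p).
Proof. by move=> lp; have := mem_nth o (_ : p < size s); rewrite size_s ltnS => /(_ lp); rewrite sb. Qed.

Let inj_s p q : p <= N.*2 -> q <= N.*2 -> nth o s p = nth o s q -> p = q.
Proof. by move=> lp lq /eqP; rewrite nth_uniq ?size_s ?ltnS // => /eqP. Qed.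

Let par_edge p : p <= N.*2 -> e (par (nth o s p)) (nth o s p).
Proof. by move=> lp; rewrite parE ?bb_tl ?bbs. Qed.

Let par_root p : p <= N.*2 -> (par (nth o s p) == o) = (p == 0).
Proof.
have h0 : par (nth o s 0) = o.
  by have [||[q]] := s_par (p := 0); rewrite ?size_s.
move=> lp; apply/eqP/eqP => [po|->//].
have [x _ xE] := root_child valid.
have := par_edge lp; have := par_edge (leq0n N.*2).
by rewrite po h0 !xE => /eqP<- /eqP/inj_s->.
Qed.

Let par_tree p : p < N.*2 -> is_tree M (par (nth o s p.+1)).
Proof.
by move=> lp; have [/eqP|//] := bb_par valid (bbs lp); rewrite par_root.
Qed.

Let par_prev p : p < N.*2 -> exists2 q, q <= p & par (nth o s p.+1) = nth o s q.
Proof.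
move=> lp; have [||[q qp ->]] := s_par (p := p.+1); rewrite ?size_s //.
  by move/eqP; rewrite par_root.
by exists q.
Qed.

Definition word (p : nat) : V := par (nth o s p.+1).

Definition slot_label (v : V) : option 'I_N.+1 :=
  [pick i | is_ret M (par (lab i)) && e v (par (lab i))].

Definition key (p : nat) : V + 'I_N.+1 :=
  if slot_label (word p) is Some i then inr i else inl (word p).

Let par_lab i r : is_ret M r -> e r (lab i) = (par (lab i) == r).
Proof. by move=> rr; rewrite parE ?leaf_lab ?orbT // eq_sym. Qed.

Let ret_label r : is_ret M r -> exists i, r = par (lab i).
Proof.
move=> rr; have [v1 [v2 [x [_ _ h]]]] := retP valid rr.
by exists x; apply/esym/eqP; rewrite -par_lab // h.
Qed.

Let ret_label_inj i j : is_ret M (par (lab i)) -> par (lab i) = par (lab j) -> i = j.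
Proof.
move=> ri ij; have [v1 [v2 [x [_ _ h]]]] := retP valid ri.
have [_ _ [hLi _] _ _] := valid.
have := par_lab i ri; rewrite eqxx h => /eqP/hLi->.
by have := par_lab j ri; rewrite -ij eqxx h => /eqP/hLi->.
Qed.

Let child_pos v w : is_tree M v -> e v w -> is_tree M w || is_leaf M w ->
  exists2 p, p < N.*2 & w = nth o s p.+1.
Proof.
move=> tv vw tw; have bw : w \in s by rewrite sb; apply: bb_child vw tw; rewrite ?tv.
have lp : index w s <= N.*2 by rewrite -ltnS -size_s index_mem.
case ip: (index w s) lp => [|p] lp.
  have := par_root (leq0n N.*2); rewrite eqxx -ip nth_index // => /eqP pw.
  by move: vw; rewrite parE // pw => /eqP vo; rewrite vo root_not_tree in tv.
by exists p; rewrite // -ip nth_index.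
Qed.

Let word_edge p : p < N.*2 -> e (word p) (nth o s p.+1).
Proof. exact: par_edge. Qed.

Let word_child v p w : p < N.*2 -> w = nth o s p.+1 -> e v w -> word p = v.
Proof. by move=> lp ->; rewrite parE ?bb_tl ?bbs // => /eqP->. Qed.

Let word_pos v : is_tree M v -> exists p1 p2, [/\ p1 < N.*2, p2 < N.*2,
  forall q, q < N.*2 -> (word q == v) = (q == p1) || (q == p2) &
  (p1 == p2) = (slot_label v : bool)].
Proof.
move=> tv; have [c1 [c2 [c12 h t1]]] := tree_children valid tv.
have e1 : e v c1 by rewrite h eqxx.
have e2 : e v c2 by rewrite h eqxx orbT.
have [p1 l1 E1] := child_pos tv e1 t1.
have pos q p c : q < N.*2 -> p < N.*2 -> c = nth o s p.+1 -> (nth o s q.+1 == c) = (q == p).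
  by move=> lq lp ->; rewrite nth_uniq ?size_s.
have [r2|nr2] := boolP (is_ret M c2).
  exists p1, p1; split=> //.
    move=> q lq; rewrite orbb -(pos q p1 c1) //; apply/eqP/eqP => [wv|/esym E].
      have := word_edge lq; rewrite wv h => /orP[/eqP//|/eqP qc].
      by have := bb_tl (bbs lq); rewrite qc ret_not_tree ?ret_not_leaf.
    exact: word_child lq E e1.
  rewrite eqxx /slot_label; have [i ci] := ret_label r2.
  by case: pickP => // /(_ i); rewrite -ci r2 e2.
have t2 : is_tree M c2 || is_leaf M c2.
  have c2o : c2 != net_root M.
    by apply/eqP => co; rewrite co no_in_root in e2.
  have [_ _ _ hV _] := valid; move: (hV _ c2o); rewrite (negPf nr2) orbF.
  by rewrite orbC.
have [p2 l2 E2] := child_pos tv e2 t2.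
exists p1, p2; split=> //.
  move=> q lq; rewrite -(pos q p1 c1) // -(pos q p2 c2) // -h.
  by apply/eqP/idP => [<-|]; [apply: word_edge|apply: word_child].
have -> : (p1 == p2) = false.
  by apply/negP => /eqP p12; rewrite E1 E2 p12 eqxx in c12.
rewrite /slot_label; case: pickP => // i /andP[ri]; rewrite h => /orP[]/eqP E.
  by move: t1; rewrite -E ret_not_tree ?ret_not_leaf.
by rewrite -E ri in nr2.
Qed.

Let slot_labelP v i : is_tree M v ->
  (slot_label v == Some i) = is_ret M (par (lab i)) && e v (par (lab i)).
Proof.
move=> tv; rewrite /slot_label; case: pickP => [j /andP[rj ej]|/(_ i) ->//].
apply/eqP/andP => [[<-]//|[ri ei]]; congr Some; apply: ret_label_inj => //.
have [c1 [c2 [_ h t1]]] := tree_children valid tv.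
have c1N r : is_ret M r -> (r == c1) = false.
  by move=> rr; apply/negP => /eqP E; move: t1; rewrite -E ret_not_tree ?ret_not_leaf.
by move: ej ei; rewrite !h !c1N //= => /eqP-> /eqP->.
Qed.

Let key_two p : p < N.*2 -> exists q, [/\ q < N.*2, q != p &
  forall q', q' < N.*2 -> (key q' == key p) = (q' == p) || (q' == q)].
Proof.
move=> lp; have tp := par_tree lp; rewrite -/(word p) in tp.
case sp: (slot_label (word p)) => [i|]; last first.
  have [p1 [p2 [l1 l2 h p12]]] := word_pos tp; rewrite sp /= in p12.
  have wE q' : q' < N.*2 -> (key q' == key p) = (word q' == word p).
    move=> lq; rewrite /key sp; case sq: (slot_label (word q')) => [j|] //.
    by apply/esym/negP => /eqP E; rewrite E sp in sq.
  have := h p lp; rewrite eqxx => /esym/orP[]/eqP pE; [subst p1; exists p2|subst p2; exists p1].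
    by rewrite eq_sym p12; split=> // q' lq; rewrite wE // h.
  by rewrite p12; split=> // q' lq; rewrite wE // h // orbC.
have : slot_label (word p) == Some i by rewrite sp.
rewrite slot_labelP // => /andP[ri ei].
have [v1 [v2 [_ [v12 hr _]]]] := retP valid ri.
have [v' v'p hr'] : exists2 v', v' != word p &
    forall u, e u (par (lab i)) = (u == word p) || (u == v').
  move: ei; rewrite hr => /orP[]/eqP E; [exists v2|exists v1].
  - by rewrite E eq_sym.
  - by move=> u; rewrite E hr.
  - by rewrite E.
  by move=> u; rewrite E hr orbC.
have tv' : is_tree M v' by apply: (ret_parent valid ri); rewrite hr' eqxx orbT.
have slE v : is_tree M v -> e v (par (lab i)) -> slot_label v = Some i.
  by move=> tv ev; apply/eqP; rewrite slot_labelP // ri.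
have s' : slot_label v' = Some i by rewrite slE // hr' eqxx orbT.
have [q1 [q2 [lq1 lq2 h' q12]]] := word_pos tv'; have /eqP {}q12 : q1 == q2 by rewrite q12 s'.
have [p1 [p2 [l1 l2 h p12]]] := word_pos tp; have /eqP {}p12 : p1 == p2 by rewrite p12 sp.
subst p2 q2.
have pE : p = p1 by have := h p lp; rewrite eqxx orbb => /esym/eqP.
exists q1; split=> //.
  apply/eqP => q1p; have := h' q1 lq1; rewrite q1p !eqxx.
  by rewrite eq_sym (negPf v'p).
move=> q' lq; rewrite /key sp pE -[q' == p1]orbb -[q' == q1]orbb -h // -h'  //.
have tq := par_tree lq; rewrite -/(word q') in tq.
rewrite -hr'; case sq: (slot_label (word q')) => [j|].
  rewrite (inj_eq (@inr_inj _ _)) -[RHS]andTb -ri -slot_labelP // sq.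
  by rewrite (inj_eq Some_inj).
by have := slot_labelP i tq; rewrite sq ri /= => <-.
Qed.

Let mate_of (p : 'I_N.*2) : 'I_N.*2 :=
  odflt p [pick q : 'I_N.*2 | (q != p) && (key q == key p)].

Let mate_ofP p : mate_of p != p /\
  forall q : 'I_N.*2, (key q == key p) = (q == p) || (q == mate_of p).
Proof.
have [q0 [lq0 q0p h]] := key_two (ltn_ord p).
rewrite /mate_of; case: pickP => [q /andP[qp kq]|/(_ (Ordinal lq0))]; last first.
  by rewrite h // -val_eqE /= q0p eqxx orbT.
split=> //= q'; rewrite h //.
by move: kq; rewrite h // -!val_eqE; rewrite -val_eqE in qp; rewrite (negPf qp) /= => /eqP->.
Qed.

Definition net_code : pcode N := [ffun p => (mate_of p, slot_label (word p))].

Let mateE p : mate net_code p = mate_of p. Proof. by rewrite /mate ffunE. Qed.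
Let lblE p : lbl net_code p = slot_label (word p). Proof. by rewrite /lbl ffunE. Qed.

Let key_mate p : key (mate_of p) = key p.
Proof. by have [_ h] := mate_ofP p; apply/eqP; rewrite h eqxx orbT. Qed.

Let key_label p q : key p = key q -> slot_label (word p) = slot_label (word q).
Proof.
rewrite /key; case sp: (slot_label (word p)) => [i|]; case sq: (slot_label (word q)) => [j|] //.
by case=> ->.
Qed.

Lemma net_code_codes : net_code \in codes N.
Proof.
apply/codesP; split=> [p|p|p|p q]; rewrite ?mateE ?lblE.
- by have [] := mate_ofP p.
- have [n1 _] := mate_ofP (mate_of p); have [_ h] := mate_ofP p.
  have := h (mate_of (mate_of p)); rewrite !key_mate eqxx (negPf n1) orbF.
  by move=> /esym/eqP.
- exact/key_label/key_mate.
case sp: (slot_label (word p)) => [i|] // _ sq; have [_ h] := mate_ofP p.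
have := h q; rewrite /key sp -sq eqxx => /esym/orP[]/eqP; by [left|right].
Qed.

Let cc := net_code_codes.

Let lab_word p : p < N.*2 -> label net_code p = slot_label (word p).
Proof. by move=> lp; rewrite (labelE _ (Ordinal lp)) lblE. Qed.

Let partner_key p q : p < N.*2 -> q < N.*2 -> key q = key p -> q != p -> partner net_code p = q.
Proof.
move=> lp lq /eqP kpq qp; rewrite (partnerE _ (Ordinal lp)) mateE.
have [_ h] := mate_ofP (Ordinal lp); move: kpq; rewrite (h (Ordinal lq)).
by rewrite -!val_eqE /= (negPf qp) => /eqP.
Qed.

Let word_tree p : p < N.*2 -> is_tree M (nth o s p) -> word p = nth o s p.
Proof. by move=> lp; apply: s_tree; rewrite size_s. Qed.

Let stale_case p : p < N.*2 -> is_tree M (nth o s p) = false ->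
  [/\ label net_code p = None, partner net_code p < p & word p = nth o s (partner net_code p)].
Proof.
move=> lp tp; have [q qp wq] := par_prev lp; rewrite -/(word p) in wq.
have tw : is_tree M (word p) by apply: par_tree.
have nqp : q != p by apply/eqP => E; rewrite -E -wq tw in tp.
have {}qp : q < p by rewrite ltn_neqAle nqp.
have lq := ltn_trans qp lp.
have wqq : word q = word p by rewrite word_tree // -wq.
have lN : slot_label (word p) = None.
  have [p1 [p2 [l1 l2 h]]] := word_pos tw.
  have := h p lp; have := h q lq; rewrite wqq eqxx.
  case: (slot_label (word p)) => //= i + + /eqP p12; rewrite p12 !orbb.
  by move=> /esym/eqP E1 /esym/eqP E2; rewrite E1 E2 eqxx in nqp.
have -> : partner net_code p = q by apply: partner_key => //; rewrite /key wqq.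
by rewrite lab_word.
Qed.

Let freshE p : p <= N.*2 -> fresh net_code p = is_tree M (nth o s p).
Proof.
rewrite leq_eqVlt => /orP[/eqP->|lp].
  rewrite /fresh ltnn; apply/esym/negP => tP.
  have [c1 [c2 [_ h t1]]] := tree_children valid tP.
  have e1 : e (nth o s N.*2) c1 by rewrite h eqxx.
  have [q lq E] := child_pos tP e1 t1.
  have [q' q'q wE] := par_prev lq.
  have := word_child lq E e1; rewrite /word wE => /inj_s.
  by rewrite (leq_trans q'q (ltnW lq)) => /(_ isT (leqnn _)) Eq; move: lq; rewrite -Eq ltnNge q'q.
case tp: (is_tree M (nth o s p)); last first.
  have [lN lt _] := stale_case lp tp.
  by rewrite /fresh lp /labelled lN /= ltnNge ltnW.
rewrite /fresh lp /labelled lab_word //; case sp: (slot_label (word p)) => [//|] /=.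
have [q [lq qp h]] := key_two lp.
have kq : key q = key p by apply/eqP; rewrite h // eqxx orbT.
rewrite (partner_key lp lq kq qp).
have wq : word q = nth o s p.
  by move: kq; rewrite /key sp (word_tree lp tp); case: slot_label => // -[].
have [q' q'q] := par_prev lq; rewrite -/(word q) wq => E.
have lq' := leq_trans q'q (ltnW lq).
have := inj_s (ltnW lp) lq' E => ->.
rewrite ltn_neqAle q'q andbT -(inj_s (ltnW lp) lq' E) eq_sym //.
Qed.

Let word_vx p : p < N.*2 -> word p = nth o s (vx net_code p).
Proof.
move=> lp; rewrite /vx (freshE (ltnW lp)); case: ifP => tp.
  exact: (word_tree lp tp).
by have [_ _ wE] := stale_case lp tp.
Qed.

Let leafN p : p <= N.*2 -> is_leaf M (nth o s p) = ~~ is_tree M (nth o s p).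
Proof.
move=> lp; have tl := bb_tl (bbs lp).
have [tp|ntp] := boolP (is_tree M (nth o s p)); first by rewrite tree_not_leaf.
by move: tl; rewrite (negPf ntp).
Qed.

Let unusedE i : (i \in unused net_code) = bb (lab i).
Proof.
have ll := leaf_lab valid i.
have -> : bb (lab i) = ~~ is_ret M (par (lab i)).
  rewrite /bb ll; case tl: (is_tree M (lab i)) => //=.
  by rewrite tree_not_leaf in ll.
apply/idP/idP => [iu|]; last first.
  apply: contraR => /unusedPn[p]; rewrite lblE => /eqP.
  by rewrite slot_labelP ?par_tree // => /andP[].
apply/negP => ri; have [v1 [v2 [x [_ h _]]]] := retP valid ri.
have e1 : e v1 (par (lab i)) by rewrite h eqxx.
have t1 := ret_parent valid ri e1.
have [p1 [p2 [l1 _ hp _]]] := word_pos t1.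
have := hp p1 l1; rewrite eqxx => /eqP w1.
move: iu; apply/negP/unusedPn; exists (Ordinal l1); rewrite lblE /= w1; apply/eqP.
by rewrite slot_labelP // ri.
Qed.

Let g (v : vtx N) : V :=
  match v with
  | VRoot => o
  | VLeaf i => lab i
  | VRet i => par (lab i)
  | VTree p => nth o s p
  end.

Let g_child p : p <= N.*2 -> g (child net_code p) = nth o s p.
Proof.
move=> lp; rewrite /child; case: ifPn => // np /=.
have ps : p \in stale net_code by rewrite mem_stale lp.
have leaves : [seq nth o s q | q <- stale net_code] = [seq lab i | i <- tips net_code].
  rewrite /tips (_ : unused net_code = [set x | bb (lab x)]%SET); last first.
    by apply/setP => i; rewrite unusedE inE.
  rewrite -/(tip_leaves M) -sl -[in RHS](mkseq_nth o s) /mkseq filter_map size_s.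
  congr map; rewrite /stale; apply: eq_in_filter => q; rewrite mem_iota ltnS => /= lq.
  by rewrite freshE // -leafN.
have lt : index p (stale net_code) < size (stale net_code) by rewrite index_mem.
have := congr1 (fun l => nth o l (index p (stale net_code))) leaves.
rewrite (nth_map 0) // nth_index // => ->.
by rewrite (nth_map ord0) // -size_stale.
Qed.

Let g_parent p : p <= N.*2 -> g (parent net_code p) = par (nth o s p).
Proof.
case: p => [_|p lp] /=; last by rewrite -word_vx.
by apply/esym/eqP; rewrite par_root.
Qed.

Let g_ret i : i \notin unused net_code -> is_ret M (par (lab i)).
Proof. by rewrite unusedE /bb leaf_lab //= negb_or negb_and negbK => /andP[]. Qed.

Let g_type v : v \in verts net_code ->
  [/\ (v = VRoot) <-> g v = o, is_tree M (g v) = (if v is VTree _ then true else false),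
      is_leaf M (g v) = (if v is VLeaf _ then true else false) &
      is_ret M (g v) = (if v is VRet _ then true else false)].
Proof.
have rl u : is_leaf M u -> is_ret M u = false by move/eqP=> h; rewrite /is_ret h.
have rt u : is_tree M u -> is_ret M u = false by move/eqP=> h; rewrite /is_ret h.
have tl u : is_leaf M u -> is_tree M u = false by move/eqP=> h; rewrite /is_tree h.
have no u : is_leaf M u \/ is_tree M u \/ is_ret M u -> u <> o.
  by move=> + uo; rewrite uo root_not_leaf ?root_not_ret ?root_not_tree // => -[|[]].
rewrite mem_verts ?cc //; case: v => [|i|i|p] /= vv.
- by rewrite root_not_leaf ?root_not_ret ?root_not_tree.
- have ll := leaf_lab valid i.
  by rewrite ll rl ?tl //; split=> //; split=> // h; case: (no (lab i)) => //; left.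
- have rr := g_ret vv; rewrite rr ret_not_tree ?ret_not_leaf //.
  by split=> //; split=> // h; case: (no (par (lab i))) => //; right; right.
have tt : is_tree M (nth o s p) by rewrite -freshE // ltnW // (fresh_lt vv).
rewrite tt rt ?tree_not_leaf //.
by split=> //; split=> // h; case: (no (nth o s p)) => //; right; left.
Qed.

Let g_inj u v : u \in verts net_code -> v \in verts net_code -> g u = g v -> u = v.
Proof.
move=> uv vv guv; have [u1 u2 u3 u4] := g_type uv; have [v1 v2 v3 v4] := g_type vv.
rewrite guv in u1 u2 u3 u4; rewrite v2 in u2; rewrite v3 in u3; rewrite v4 in u4.
have [_ _ [hLi _] _ _] := valid.
case: u uv u1 u2 u3 u4 guv => [|i|i|p] uv u1 u2 u3 u4;
  case: v vv v1 v2 v3 v4 u1 u2 u3 u4 => [|j|j|q] vv v1 v2 v3 v4 u1 u2 u3 u4 //= guv.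
- by rewrite (hLi _ _ guv).
- congr VRet; apply: ret_label_inj guv; apply: g_ret.
  by move: uv; rewrite mem_verts ?cc.
move: uv vv; rewrite !mem_verts ?cc // => fp fq.
by rewrite (inj_s _ _ guv) // ltnW // (fresh_lt fp, fresh_lt fq).
Qed.

Let g_edge u v : u \in verts net_code -> v \in verts net_code ->
  vedge net_code u v = e (g u) (g v).
Proof.
move=> uv vv; have [E|[i iu [E|E]]|[p lp E]] := vertsP cc vv; rewrite E.
- by rewrite /= no_in_root.
- have ri := g_ret iu; case: u uv => [|j|j|q] uv /=.
  + apply/esym/negP => /(ret_parent valid ri).
    by rewrite root_not_tree.
  + apply/esym/negP => /(ret_parent valid ri) h.
    by have := leaf_lab valid j; rewrite tree_not_leaf.
  + apply/esym/negP => /(ret_parent valid ri).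
    by rewrite ret_not_tree // g_ret //; move: uv; rewrite mem_verts ?cc.
  have fq : fresh net_code q by move: uv; rewrite mem_verts ?cc.
  have lq := fresh_lt fq; have tq : is_tree M (nth o s q) by rewrite -freshE // ltnW.
  by rewrite lab_word // word_tree // slot_labelP // ri.
- have rv : VRet i \in verts net_code by rewrite mem_verts ?cc.
  rewrite /= (negPf iu) parE ?leaf_lab ?orbT //.
  by apply/eqP/eqP => [->//|]; apply: (g_inj uv rv).
rewrite vedge_child // g_child // parE ?bb_tl ?bbs // -g_parent //.
apply/eqP/eqP => [->//|]; apply: g_inj => //; exact: parent_verts.
Qed.

Let g_surj w : exists2 v, v \in verts net_code & g v = w.
Proof.
have [_ _ [_ hL] hV _] := valid.
have [->|wo] := eqVneq w o; first by exists VRoot; rewrite // mem_verts ?cc.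
case/or3P: (hV w wo) => [/hL[i iw]|tw|rw].
- by exists (VLeaf i); rewrite // mem_verts ?cc.
- have ws : w \in s by rewrite sb; apply/orP; left.
  exists (VTree (index w s)); rewrite /= ?nth_index // mem_verts ?cc //.
  have li : index w s <= N.*2 by rewrite -ltnS -size_s index_mem.
  by rewrite freshE // nth_index.
have [i iw] := ret_label rw; exists (VRet i); rewrite // mem_verts ?cc //.
by rewrite unusedE /bb leaf_lab //= -iw rw orbF; apply/negP => /tree_not_leaf;
  rewrite leaf_lab.
Qed.

Lemma net_code_iso : network_iso (net net_code) M.
Proof.
exists (fun v => g (val v)); split=> //.
- apply: inj_card_bij => [u v /(g_inj (val_verts u) (val_verts v))/val_inj//|].
  rewrite -(card_codom (f := fun v : seq_sub (verts net_code) => g (val v))).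
    apply/subset_leq_card/fintype.subsetP => w _; have [v vv <-] := g_surj w.
    by apply/codomP; exists (SeqSub vv).
  by move=> u v /(g_inj (val_verts u) (val_verts v))/val_inj.
- by move=> u v; rewrite net_edgeE g_edge ?val_verts.
by move=> i; rewrite ffunE.
Qed.

End NetworkCode.

Lemma exists_code N (V : finType) (M : network 'I_N.+1 V) :
  simplex_tree_child M -> exists2 c, c \in codes N & network_iso (net c) M.
Proof.
move=> valid; have [s [us sb sl s_tree s_par]] := backbone_enum valid.
exists (net_code M s).
  by apply: net_code_codes.
by apply: net_code_iso.
Qed.

(** * Balls around the root *)

Lemma mgraph_iso_sym (G H : mgraph) : mgraph_iso G H -> mgraph_iso H G.
Proof.
case=> f [[g fK gK] fb fm fe]; exists g; split.
- by exists f.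
- by rewrite -fb fK.
- by move=> v; rewrite -fm gK.
by move=> u v; rewrite fe !gK.
Qed.

Lemma mgraph_iso_trans (G H K : mgraph) :
  mgraph_iso G H -> mgraph_iso H K -> mgraph_iso G K.
Proof.
case=> f [fb f0 fm fe] [g [gb g0 gm ge]]; exists (g \o f); split.
- exact: bij_comp.
- by rewrite /= f0.
- by move=> v; rewrite /= gm fm.
by move=> u v; rewrite fe ge.
Qed.

Section LocalIso.
Variables (H G : mgraph) (phi : vert H -> vert G) (sz : vert H -> nat) (r : nat).
Hypotheses (phi_base : phi (base H) = base G) (sz_base : sz (base H) = 0)
  (sz_adj : forall u v, Defs.adjacent u v -> sz v <= (sz u).+1)
  (phi_mark : forall u, sz u <= r -> mark (phi u) = mark u)
  (phi_edge : forall u v, sz u <= r.+1 -> sz v <= r.+1 -> edge u v -> edge (phi u) (phi v))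
  (phi_inj : forall u v, sz u <= r.+1 -> sz v <= r.+1 -> phi u = phi v -> u = v)
  (lift_out : forall u w, sz u <= r -> edge (phi u) w -> exists2 v, edge u v & phi v = w)
  (lift_in : forall u w, sz u <= r -> edge w (phi u) -> exists2 v, edge v u & phi v = w).

Local Notation adjb := (fun x y => `[< Defs.adjacent x y >]).

Lemma path_size u p : path adjb u p -> sz (last u p) <= sz u + size p.
Proof.
elim: p u => [|v p IH] u /=; first by rewrite addn0.
by move=> /andP[/asboolP/sz_adj uv /IH h]; lia.
Qed.

Lemma path_map u p : path adjb u p -> sz u + size p <= r.+1 ->
  path adjb (phi u) (map phi p).
Proof.
elim: p u => //= v p IH u /andP[/asboolP uv pp] le.
have svu := sz_adj uv; apply/andP; split; last by apply: IH => //; lia.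
by apply/asboolP; case: uv => uv; [left|right]; apply: phi_edge => //; lia.
Qed.

Lemma path_lift u q : path adjb (phi u) q -> sz u + size q <= r ->
  exists2 p, path adjb u p & map phi p = q.
Proof.
elim: q u => [|w q IH] u /=; first by exists [::].
move=> /andP[/asboolP uw pq] le.
have [v uv vw] : exists2 v, Defs.adjacent u v & phi v = w.
  case: uw => [/lift_out|/lift_in] [|v uv vw]; try lia; exists v => //; [by left|by right].
subst w; have svu := sz_adj uv; have [|p pp pE] := IH v pq; first by lia.
by exists (v :: p); rewrite /= ?pE // pp andbT; apply/asboolP.
Qed.

Lemma ball_size v : dist_le r (base H) v -> sz v <= r.
Proof.
case=> p [pp <- sp]; apply: leq_trans (path_size pp) _.
by rewrite sz_base.
Qed.

Lemma ball_map v : dist_le r (base H) v -> dist_le r (base G) (phi v).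
Proof.
case=> p [pp <- sp]; exists (map phi p); rewrite -phi_base last_map size_map.
by split=> //; apply: path_map => //; rewrite sz_base; lia.
Qed.

Lemma ball_lift w : dist_le r (base G) w -> exists2 v, dist_le r (base H) v & phi v = w.
Proof.
case=> q [pq <- sq]; rewrite -phi_base in pq *.
have [|p pp pE] := path_lift pq; first by rewrite sz_base.
exists (last (base H) p); last by rewrite -pE last_map.
by exists p; split=> //; rewrite -pE size_map in sq.
Qed.

Lemma ball_iso : mgraph_iso (ball_graph r H) (ball_graph r G).
Proof.
pose f (x : vert (ball_graph r H)) : vert (ball_graph r G) :=
  exist _ (phi (val x)) (mem_set (ball_map (set_mem (valP x)))).
have szx (x : vert (ball_graph r H)) : sz (val x) <= r := ball_size (set_mem (valP x)).
have szx' (x : vert (ball_graph r H)) : sz (val x) <= r.+1 := leqW (szx x).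
exists f; split.
- have fi x y : f x = f y -> x = y.
    by move=> /(congr1 val)/= /phi_inj-/(_ (szx' x) (szx' y)) /val_inj.
  have fs y : {x | f x = y}.
    apply: cid; have [v vb vE] := ball_lift (set_mem (valP y)).
    by exists (exist _ v (mem_set vb)); apply: val_inj.
  exists (fun y => sval (fs y)) => [x|y]; last exact: svalP (fs y).
  exact/fi/(svalP (fs (f x))).
- by apply: val_inj; rewrite /= phi_base.
- by move=> x; apply: phi_mark.
move=> x y; split=> /= xy; first by apply: phi_edge xy; apply: szx'.
have [v xv vE] := lift_out (szx x) xy.
suff -> : val y = v by [].
apply: phi_inj => //.
by have := sz_adj (or_introl xv); have := szx x; lia.
Qed.

End LocalIso.

Lemma ball_graph_iso (r : nat) (G H : mgraph) :
  mgraph_iso G H -> mgraph_iso (ball_graph r G) (ball_graph r H).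
Proof.
case=> f [[g fK gK] fb fm fe].
have dl (K L : mgraph) (h : vert K -> vert L) v : h (base K) = base L ->
    (forall u v, edge u v <-> edge (h u) (h v)) ->
    dist_le r (base K) v -> dist_le r (base L) (h v).
  move=> hb he [p [pp <- sp]]; exists (map h p); rewrite -hb last_map size_map; split=> //.
  elim: p (base K) pp {sp} => //= y p IH x /andP[/asboolP xy /IH->]; rewrite andbT.
  by apply/asboolP; case: xy => /he; [left|right].
have ge u v : edge u v <-> edge (g u) (g v) by rewrite fe !gK.
have gb : g (base H) = base G by rewrite -fb fK.
exists (fun x => exist _ (f (val x)) (mem_set (dl G H f _ fb fe (set_mem (valP x)))));
  split=> [|||u v] //=.
- exists (fun y => exist _ (g (val y)) (mem_set (dl H G g _ gb ge (set_mem (valP y))))) => x;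
    by apply: val_inj; rewrite /= ?fK ?gK.
- by apply: val_inj.
Qed.

Fixpoint dsize (x : dec_vertex) : nat :=
  match x with
  | RootSpine t => t.+1
  | Before y k | After y k => dsize y + k.+3
  end.

Definition hsize (v : hat_vertex) : nat :=
  match v with
  | HRoot => 0
  | HDec x => dsize x
  | HRet x => (dsize x).+1
  | HLeaf x | HW x => (dsize x).+2
  end.

Definition hup (v : hat_vertex) : hat_vertex :=
  match v with
  | HDec (RootSpine t.+1) => HDec (RootSpine t)
  | HDec (Before x k) => HDec (Before x k.+1)
  | HDec (After x 0) => HW x
  | HDec (After x k.+1) => HDec (After x k)
  | HW x => HDec (Before x 0)
  | _ => HRoot
  end.

Definition hdown (v : hat_vertex) : hat_vertex :=
  match v with
  | HRoot => HDec (RootSpine 0)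
  | HDec (RootSpine t) => HDec (RootSpine t.+1)
  | HDec (Before x 0) => HW x
  | HDec (Before x k.+1) => HDec (Before x k)
  | HDec (After x k) => HDec (After x k.+1)
  | HW x => HDec (After x 0)
  | v => v
  end.

Definition is_spine (v : hat_vertex) : bool :=
  match v with HDec _ | HW _ => true | _ => false end.

Lemma hat_edgeP u v : hat_edge u v <->
  match v with
  | HRoot => False
  | HDec _ | HW _ => u = hup v
  | HRet x => u = HDec x \/ u = HW x
  | HLeaf x => u = HRet x
  end.
Proof.
split=> [|].
  case=> [|t|x [[|k]|[|k]]|x|x|x] //=; try by [left|right].
    by rewrite addn1.
  by rewrite subn1.
case: v => [|x|x|x|x] //.
- case: x => [[|t]|x k|x [|k]] -> /=; try by constructor.
  + by have := hat_edge_spine x (Negz k.+1); rewrite /= subn1.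
  + exact: (hat_edge_spine x 0).
  by have := hat_edge_spine x (Posz k.+1); rewrite /= addn1.
- by case=> ->; constructor.
- by move=> ->; constructor.
move=> ->; exact: (hat_edge_spine x (Negz 0)).
Qed.

Lemma hup_down u : is_spine u || (if u is HRoot then true else false) ->
  is_spine (hdown u) /\ hup (hdown u) = u.
Proof. by case: u => [|[t|x [|k]|x k]|x|x|x]. Qed.

Lemma hsize_adj (u v : vert hatN) : Defs.adjacent u v -> hsize v <= (hsize u).+1.
Proof.
have sz a b : hat_edge a b -> hsize a <= (hsize b).+1 /\ hsize b <= (hsize a).+1.
  move=> /hat_edgeP; case: b => [//|[[|t]|x k|x [|k]]|x|x|x]; try by move=> -> /=; lia.
  by case=> -> /=; lia.
by case=> /sz[].
Qed.

Section BallOfCode.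
Variables (N r D : nat) (c : pcode N) (s : seq dec_vertex).
Hypotheses (rD : r.+3 <= D) (cc : c \in codes N) (okc : ok D c s) (wfs : wf D s)
  (covers : forall x, dsize x <= D -> x \in s).

Let u : uniq (occ D c s). Proof. by have /andP[] := okc. Qed.
Let av x : dsize x <= D -> avail D s x. Proof. by move=> /covers/wfs. Qed.

Let lab_pos x : dsize x <= D -> labelled c (pos c x).
Proof. by move=> dx; have /andP[_ /allP] := okc; apply; apply/pos_occ/av. Qed.

Let lab_wpos x : dsize x <= D -> labelled c (wpos c x).
Proof. by move=> dx; rewrite /labelled label_partner //; apply: lab_pos. Qed.

Let wpos_gt x : dsize x <= D -> D < wpos c x.
Proof.
move=> dx; rewrite ltnNge; apply/negP => le.
apply: (win_root u (covers dx) (t := 0)); first by lia.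
by have := mem_win (wpos c x) (leq0n D.*2); rewrite addn0 (eqP le).
Qed.

Definition hpos (v : hat_vertex) : nat :=
  match v with
  | HDec x => pos c x
  | HW x => wpos c x
  | _ => 0
  end.

Definition hlab (x : dec_vertex) : 'I_N.+1 := odflt ord0 (label c (pos c x)).

Definition hvtx (v : hat_vertex) : vtx N :=
  match v with
  | HRoot => VRoot
  | HDec _ | HW _ => VTree (hpos v)
  | HRet x => VRet (hlab x)
  | HLeaf x => VLeaf (hlab x)
  end.

Let hlabE x : dsize x <= D -> label c (pos c x) = Some (hlab x).
Proof. by move=> /lab_pos; rewrite /labelled /hlab; case: label. Qed.

Let hlab_used x : dsize x <= D -> hlab x \notin unused c.
Proof.
move=> dx; have l := hlabE dx; have lp : pos c x < N.*2.
  by apply: (@label_lt _ c); rewrite l.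
by apply/unusedPn; exists (Ordinal lp); rewrite -labelE.
Qed.

Let lab_hpos v : is_spine v -> hsize v <= r.+3 -> labelled c (hpos v).
Proof.
case: v => //= x _ le; first by apply: lab_pos; lia.
by apply: lab_wpos; lia.
Qed.

Let hvtx_verts v : hsize v <= r.+3 -> hvtx v \in verts c.
Proof.
rewrite mem_verts //; case: v => //= x le.
- by apply/label_fresh/lab_pos; lia.
- by apply: hlab_used; lia.
by apply/label_fresh/lab_wpos; lia.
Qed.

Let hvtx_inj v w : hsize v <= r.+3 -> hsize w <= r.+3 -> hvtx v = hvtx w -> v = w.
Proof.
have pI x y : dsize x <= D -> dsize y <= D -> pos c x = pos c y -> x = y.
  by move=> dx dy; apply: pos_inj u (av dx) (av dy).
have pW x y : dsize x <= D -> dsize y <= D -> pos c x <> wpos c y.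
  by move=> dx dy; apply/eqP/(pos_wpos u (av dx) (covers dy)).
have lI x y : dsize x <= D -> dsize y <= D -> hlab x = hlab y -> x = y.
  move=> dx dy e; have [||] := label_inj cc (lab_pos dx) (q := pos c y).
  - by rewrite !hlabE // e.
  - by move=> /esym; apply: pI.
  by move/(pW y x dy dx).
case: v w => [|x|x|x|x] [|y|y|y|y] //= dx dy [].
- by move/pI=> -> //; lia.
- by move/pW => []; lia.
- by move/lI => -> //; lia.
- by move/lI => -> //; lia.
- by move/esym/pW => []; lia.
by move=> /(congr1 (partner c)); rewrite !partnerK // => /pI -> //; lia.
Qed.

Let hup_parent v : is_spine v -> hsize v <= r.+2 -> parent c (hpos v) = hvtx (hup v).
Proof.
have vxl p : labelled c p -> vx c p = p by move=> l; apply/vxE/label_fresh.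
case: v => // [[[|t]|x k|x [|k]]|x] //= _ le.
- by rewrite vxl //; apply: (lab_pos (x := RootSpine t)) => /=; lia.
- have gt := wpos_gt (x := x) ltac:(lia); rewrite -!/(wpos c x).
  have -> : wpos c x - k.+1 = (wpos c x - k.+2).+1 by lia.
  by rewrite /= vxl //; apply: (lab_pos (x := Before x k.+1)) => /=; lia.
- by rewrite addn1 /= vxl //; apply: lab_wpos; lia.
- by rewrite addnS /= vxl //; apply: (lab_pos (x := After x k)) => /=; lia.
have gt := wpos_gt (x := x) ltac:(lia); rewrite -!/(wpos c x).
have -> : wpos c x = (wpos c x - 1).+1 by lia.
by rewrite /= vxl ?subn1 //; have := lab_pos (x := Before x 0); rewrite /= subn1; apply; lia.
Qed.

Let parent_inj p p' : p <= N.*2 -> p' <= N.*2 -> parent c p = parent c p' ->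
  (forall q, parent c p = VTree q -> labelled c q) -> p = p'.
Proof.
case: p p' => [|p] [|p'] //= lp lp' [e] lq; have {}lq := lq _ erefl.
have fq := label_fresh lq.
have pE a : a < N.*2 -> vx c a = vx c p -> a = vx c p.
  move=> la /eqP; rewrite vx_eq // => /orP[/eqP//|/andP[/eqP lN]].
  by move: lq; rewrite /labelled lN.
by rewrite [p](pE p) // [p'](pE p') // e.
Qed.

Let vedge_in v w : w \in verts c -> hsize v <= r.+1 -> vedge c w (hvtx v) ->
  exists2 v', hat_edge v' v & hvtx v' = w.
Proof.
move=> ww le; case: v le => [|x|x|x|x] le //.
- have l := lab_hpos (v := HDec x) isT (leqW (leqW le)).
  rewrite /= => /eqP->; exists (hup (HDec x)); first exact/hat_edgeP.
  by rewrite -hup_parent // (leqW le).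
- case: w ww => // p _ /= /eqP lp.
  have dx : dsize x <= D by move: le => /=; lia.
  have [|->|->] := label_inj cc (lab_pos dx) (q := p).
  - by rewrite hlabE.
  - by exists (HDec x) => //; constructor.
  by exists (HW x) => //; constructor.
- rewrite /= (negPf (hlab_used _)); last by move: le => /=; lia.
  by move=> /eqP->; exists (HRet x) => //; constructor.
rewrite /= => /eqP->; exists (hup (HW x)); first exact/hat_edgeP.
by rewrite -hup_parent // (leqW le).
Qed.

Let vedge_hom v w : hsize v <= r.+1 -> hsize w <= r.+1 -> hat_edge v w ->
  vedge c (hvtx v) (hvtx w).
Proof.
move=> lv lw /hat_edgeP; case: w lw => [|x|x|x|x] // lw.
- by move=> ->; apply/eqP/esym/(hup_parent (v := HDec x)) => //; apply: leqW.
- have dx : dsize x <= D by move: lw => /=; lia.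
  by case=> -> /=; rewrite ?label_partner // hlabE.
- by move=> ->; rewrite /= (negPf (hlab_used _)) //; move: lw => /=; lia.
by move=> ->; apply/eqP/esym/(hup_parent (v := HW x)) => //; apply: leqW.
Qed.

Let vedge_outl v w : w \in verts c -> hsize v <= r.+1 -> vedge c (hvtx v) w ->
  exists2 v', hat_edge v v' & hvtx v' = w.
Proof.
move=> ww le /(vedge_out cc ww)[[p lp [pE ->]]|[p vE [i lpi ->]]|[i iu [vE ->]]].
- have sv : is_spine v || (if v is HRoot then true else false).
    by case: v le pE => //= x _; case: p lp.
  have [sd du] := hup_down sv.
  have ed : hat_edge v (hdown v).
    by apply/hat_edgeP; case: (hdown v) sd du => //= ? _ ->.
  have ld : hsize (hdown v) <= r.+2.
    exact: leq_trans (hsize_adj (or_introl ed)) _.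
  exists (hdown v) => //.
  have ldl := lab_hpos sd (leqW ld).
  have -> : hvtx (hdown v) = VTree (hpos (hdown v)) by case: (hdown v) sd.
  rewrite -(child_fresh (label_fresh ldl)); congr child.
  have pE' := hup_parent sd ld; rewrite du in pE'.
  apply: parent_inj => //; first exact/ltnW/(label_lt ldl).
    by rewrite pE' pE.
  move=> q; rewrite pE'; case: v le {pE sv sd du ed ld ldl pE'} => //= x le [<-].
    by apply: lab_pos; lia.
  by apply: lab_wpos; lia.
- case: v le vE => //= x le [pE]; exists (HRet x); try by constructor.
    by rewrite /= /hlab pE lpi.
  by rewrite /= /hlab -(label_partner _ cc) -/(wpos c x) pE lpi.
case: v le vE => //= x le [<-]; exists (HLeaf x) => //; by constructor.
Qed.

Lemma ball_of_code : mgraph_iso (ball_graph r hatN) (ball_graph r (mgraph_of (net c))).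
Proof.
pose phi v : seq_sub (verts c) := insubd (SeqSub (root_verts c)) (hvtx v).
have phiE v : hsize v <= r.+2 -> val (phi v) = hvtx v.
  by move=> lv; rewrite /phi val_insubd (hvtx_verts (leqW lv)).
apply: (@ball_iso hatN (mgraph_of (net c)) phi hsize r) => //.
- by apply: val_inj; rewrite phiE.
- exact: hsize_adj.
- move=> v lv; have lv2 : hsize v <= r.+2 by lia.
  rewrite /= /net_mark is_leafE // is_retE // -val_eqE phiE //=.
  by case: v lv {lv2}.
- by move=> v w lv lw vw; rewrite /= net_edgeE (phiE _ (leqW lv)) (phiE _ (leqW lw)); apply: vedge_hom.
- by move=> v w lv lw /(congr1 val); rewrite (phiE _ (leqW lv)) (phiE _ (leqW lw)) => /hvtx_inj; apply; lia.
- move=> v w lv; rewrite /= net_edgeE phiE; last by lia.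
  move=> /(vedge_outl (val_verts w) (leqW lv))[v' vv' v'w]; exists v' => //.
  apply: val_inj; rewrite phiE //.
  by have := hsize_adj (or_introl vv' : @Defs.adjacent hatN v v'); lia.
move=> v w lv; rewrite /= net_edgeE phiE; last by lia.
move=> /(vedge_in (val_verts w) (leqW lv))[v' vv' v'w]; exists v' => //.
apply: val_inj; rewrite phiE //.
by have := hsize_adj (or_intror vv' : @Defs.adjacent hatN v v'); lia.
Qed.

End BallOfCode.

(** * Convergence *)

Section NetworkIso.
Variables (X : finType).

Lemma network_iso_sym (V W : finType) (M : network X V) (K : network X W) :
  network_iso M K -> network_iso K M.
Proof.
case=> f [[g fK gK] fr fe fl]; exists g; split.
- by exists f.
- by rewrite -fr fK.
- by move=> u v; rewrite fe !gK.
by move=> x; rewrite -fl fK.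
Qed.

Lemma network_iso_trans (U V W : finType) (L : network X U) (M : network X V)
    (K : network X W) : network_iso L M -> network_iso M K -> network_iso L K.
Proof.
case=> f [fb fr fe fl] [g [gb gr ge gl]]; exists (g \o f); split=> /=.
- exact: bij_comp.
- by rewrite fr.
- by move=> u v; rewrite fe ge.
by move=> x; rewrite fl gl.
Qed.

Lemma iso_degrees (V W : finType) (M : network X V) (K : network X W) (f : V -> W) v :
  bijective f -> (forall u w, net_edge M u w = net_edge K (f u) (f w)) ->
  degrees K (f v) = degrees M v.
Proof.
move=> fb fe; have fi := bij_inj fb; case: (fb) => g fK gK; rewrite /degrees; congr (_, _).
  rewrite -(fintype.card_image fi [pred u | net_edge M u v]); apply: eq_card => w.
  by rewrite -[w]gK fintype.mem_image // !inE fe.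
rewrite -(fintype.card_image fi [pred u | net_edge M v u]); apply: eq_card => w.
by rewrite -[w]gK fintype.mem_image // !inE fe.
Qed.

Lemma iso_valid (V W : finType) (M : network X V) (K : network X W) :
  network_iso M K -> simplex_tree_child M -> simplex_tree_child K.
Proof.
case=> f [fb fr fe fl] [hA [hR hC] [hLi hL] hV [hT hO]].
have dE v : degrees K (f v) = degrees M v by apply: iso_degrees.
have lE v : is_leaf K (f v) = is_leaf M v by rewrite /is_leaf dE.
have tE v : is_tree K (f v) = is_tree M v by rewrite /is_tree dE.
have rE v : is_ret K (f v) = is_ret M v by rewrite /is_ret dE.
have fi := bij_inj fb; case: fb => g fK gK.
have ge u w : net_edge K u w = net_edge M (g u) (g w) by rewrite fe !gK.
split.
- move=> v p; apply/negP => cyc; apply: (negP (hA (g v) (map g p))).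
  rewrite -[g v :: _]/(map g (v :: p)); move: cyc; apply: homo_cycle => u w.
  by rewrite ge.
- split=> [|v]; first by rewrite -fr dE.
  rewrite -fr -[v]gK; have /connectP[p pp ->] := hC (g v).
  apply/connectP; exists (map f p); last by rewrite last_map.
  by move: pp; apply: homo_path => u w; rewrite fe.
- split=> [x y|v]; first by rewrite -!fl => /fi/hLi.
  rewrite -[v]gK lE hL; split=> -[x e]; exists x; first by rewrite -fl e.
  by apply: fi; rewrite fl.
- move=> v vo; rewrite -[v]gK lE tE rE; apply: hV.
  by apply: contra vo => /eqP e; rewrite -fr -e gK.
split=> [v|v w].
  rewrite -[v]gK lE => /hT[c vc ct]; exists (f c); rewrite ?lE ?tE //.
  by rewrite -fe.
by rewrite -[v]gK -[w]gK rE lE -fe; apply: hO.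
Qed.

Lemma iso_mgraph (V W : finType) (M : network X V) (K : network X W) :
  network_iso M K -> mgraph_iso (mgraph_of M) (mgraph_of K).
Proof.
case=> f [fb fr fe fl]; exists f; split=> // [v|u v]; last by rewrite /= fe.
have dE : degrees K (f v) = degrees M v by apply: iso_degrees.
by rewrite /= /net_mark /is_leaf /is_ret dE -fr (inj_eq (bij_inj fb)).
Qed.

Definition ord_copy (V : finType) (M : network X V) : network X 'I_#|V| :=
  Network [set e | net_edge M (enum_val e.1) (enum_val e.2)]%SET
    (enum_rank (net_root M)) [ffun x => enum_rank (net_label M x)].

Lemma ord_copy_iso (V : finType) (M : network X V) : network_iso M (ord_copy M).
Proof.
exists enum_rank; split=> //.
- by move=> u v; rewrite /net_edge inE /= !enum_rankK.
by move=> x; rewrite ffunE.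
Qed.

End NetworkIso.

Section Probability.
Variables (N : nat) (A : mgraph -> Prop).
Hypothesis A_iso : forall G H, mgraph_iso G H -> A G -> A H.

Let rel_iso (M K : bnetwork N.+1) := `[< network_iso (tagged M) (tagged K) >].
Let valid_nets := [set M : bnetwork N.+1 | `[< simplex_tree_child (tagged M) >]]%SET.

Let bnet_of (c : pcode N) (cc : c \in codes N) :
  {M : bnetwork N.+1 | network_iso (net c) (tagged M)}.
Proof.
have lt : #|{: seq_sub (verts c)}| < (4 * N.+1).+1.
  by have := simplex_tree_child_card (net_valid cc); rewrite card_ord.
exists (@Tagged _ (Ordinal lt) (fun m : 'I_(4 * N.+1).+1 => network 'I_N.+1 'I_m)
  (ord_copy (net c))).
exact: ord_copy_iso.
Qed.

Let net_class (c : pcode N) : {set bnetwork N.+1} :=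
  [set M in valid_nets | `[< network_iso (net c) (tagged M) >]]%SET.

Let net_class_inj : {in codes N &, injective net_class}.
Proof.
move=> c c' cc cc' e; apply: net_inj => //.
have [M cM] := bnet_of cc.
have : M \in net_class c.
  by rewrite !inE; apply/andP; split; apply/asboolP => //; apply: iso_valid cM (net_valid cc).
rewrite e inE => /andP[_ /asboolP c'M].
exact: network_iso_trans cM (network_iso_sym c'M).
Qed.

Let classE c M : M \in valid_nets -> network_iso (net c) (tagged M) ->
  net_class c = [set K in valid_nets | rel_iso M K]%SET.
Proof.
move=> vM cM; apply/setP => K; rewrite !inE; congr (_ && _); apply/asboolP/asboolP.
  exact/network_iso_trans/network_iso_sym.
exact: network_iso_trans.
Qed.

Let networksE : networks N.+1 = [set net_class c | c in codes N]%SET.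
Proof.
apply/setP => B; apply/imsetP/imsetP => [[M vM ->]|[c cc ->]].
  have : simplex_tree_child (tagged M) by move: vM; rewrite inE => /asboolP.
  by move=> /exists_code[c cc cM]; exists c; rewrite ?(classE vM cM).
have [M cM] := bnet_of cc; have vM : M \in valid_nets.
  by rewrite inE; apply/asboolP/(iso_valid cM)/net_valid.
by exists M; rewrite // (classE vM cM).
Qed.

Let class_prop c : c \in codes N ->
  [exists M in net_class c, `[< A (mgraph_of (tagged M)) >]] = `[< A (mgraph_of (net c)) >].
Proof.
move=> cc; apply/existsP/asboolP => [[M /andP[]]|Ac].
  rewrite inE => /andP[_ /asboolP cM] /asboolP; apply: A_iso.
  exact/iso_mgraph/network_iso_sym.
have [M cM] := bnet_of cc; exists M; rewrite !inE -andbA; apply/and3P; split; apply/asboolP => //.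
  exact: iso_valid cM (net_valid cc).
exact: A_iso (iso_mgraph cM) Ac.
Qed.

Lemma prob_codes (R : realType) : prob_net R N.+1 A =
  (#|[set c in codes N | `[< A (mgraph_of (net c)) >]]%SET|%:R / #|codes N|%:R)%R.
Proof.
rewrite /prob_net networksE card_in_imset //; congr (_%:R / _)%R.
rewrite -[RHS](card_in_imset (f := net_class)); last first.
  by move=> c c'; rewrite !inE => /andP[cc _] /andP[cc' _]; apply: net_class_inj; rewrite inE.
apply: eq_card => B; rewrite inE; apply/andP/imsetP => [[/imsetP[c cc ->]]|[c + ->]].
  by rewrite class_prop // => Ac; exists c; rewrite // inE cc.
by rewrite inE => /andP[cc Ac]; rewrite class_prop //; split=> //; apply: imset_f.
Qed.

End Probability.

Section Limit.
Variable R : realType.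

Lemma negl_cvg (B : forall N, pcode N -> bool) : negl B ->
  ((fun n => #|[set c in codes n.-1 | B n.-1 c]%SET|%:R / #|codes n.-1|%:R : R)%R
     @ \oo --> (0 : R)%R)%classic.
Proof.
move=> nB; apply/cvgr0Pnorm_lt => e e0.
have [N0 h] := nB (Num.truncn e^-1).+1.
exists N0.+1 => // -[//|n] /= N0n; have {h} := h n N0n.
have d0 : (0 < #|codes n|%:R :> R)%R by rewrite ltr0n codes_gt0.
move: #|[set c in codes n | B n c]%SET| => m; rewrite -(ler_nat R) natrM => le.
rewrite ger0_norm ?divr_ge0 ?ler0n // ltr_pdivrMr // -ltr_pdivrMl //.
have lt : (e^-1 < (Num.truncn e^-1).+1%:R :> R)%R by apply: truncnS_gt.
have [->|m0] := posnP m; first by rewrite mulr0.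
by apply: lt_le_trans le; rewrite ltr_pM2r // ltr0n.
Qed.

Lemma dec_cover D : exists l, all (bounded D) l /\ forall x, dsize x <= D -> x \in l.
Proof.
have ext n : n <= D -> exists l, all (bounded D) l /\ forall x, dsize x <= n -> x \in l.
  elim: n => [_|n IH nD]; first by exists [::]; split=> // -[t|x k|x k] /=; lia.
  have [l [bl hl]] := IH (ltnW nD).
  exists ([seq RootSpine t | t <- iota 0 D] ++ [seq Before x k | x <- l, k <- iota 0 D] ++
    [seq After x k | x <- l, k <- iota 0 D]); split.
    rewrite !all_cat; apply/and3P; split; apply/allP => y.
    - by move=> /mapP[t]; rewrite mem_iota => /andP[_ tD] ->.
    - by move=> /allpairsP[[x k] /= [/(allP bl) bx]]; rewrite mem_iota => /andP[_ kD] -> /=; rewrite bx.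
    - by move=> /allpairsP[[x k] /= [/(allP bl) bx]]; rewrite mem_iota => /andP[_ kD] -> /=; rewrite bx.
  move=> [t|x k|x k] /= dx; rewrite !mem_cat; apply/or3P.
  - by constructor 1; apply: map_f; rewrite mem_iota; lia.
  - constructor 2; apply/allpairsP; exists (x, k); rewrite /= mem_iota hl; last by lia.
    by split=> //; lia.
  - constructor 3; apply/allpairsP; exists (x, k); rewrite /= mem_iota hl; last by lia.
    by split=> //; lia.
exact: (ext D).
Qed.

Lemma negl_ball r : negl (fun N c =>
  ~~ `[< mgraph_iso (ball_graph r (mgraph_of (net c))) (ball_graph r hatN) >]).
Proof.
have [l [bl hl]] := dec_cover r.+3.
have [s [ws ls no]] := negl_cover bl.
apply: (negl_sub no) => N c cc; apply: contra => okc; apply/asboolP/mgraph_iso_sym.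
by apply: (ball_of_code (leqnn _) cc okc ws) => x /hl/ls.
Qed.

Lemma prob_cvg0 (A : mgraph -> Prop) : (forall G H, mgraph_iso G H -> A G -> A H) ->
  negl (fun N c => `[< A (mgraph_of (net c)) >]) ->
  (prob_net R n A @[n --> \oo] --> (0 : R)%R)%classic.
Proof.
move=> A_iso nA; apply: cvg_trans (negl_cvg nA); apply: near_eq_cvg.
by exists 1 => // -[//|N] _ /=; rewrite prob_codes.
Qed.

Lemma prob_cvg1 (A : mgraph -> Prop) : (forall G H, mgraph_iso G H -> A G -> A H) ->
  negl (fun N c => ~~ `[< A (mgraph_of (net c)) >]) ->
  (prob_net R n A @[n --> \oo] --> (1 : R)%R)%classic.
Proof.
move=> A_iso nA.
pose q n : R := (#|[set c in codes n.-1 | ~~ `[< A (mgraph_of (net c)) >]]%SET|%:R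
  / #|codes n.-1|%:R)%R.
have h : (1 - q n @[n --> \oo] --> (1 - 0 : R)%R)%classic%R.
  by apply: (@cvgB _ R^o); [exact: cvg_cst|exact: negl_cvg nA].
rewrite subr0 in h; apply: cvg_trans h; apply: near_eq_cvg; rewrite /q.
exists 1 => // -[//|N] _ /=; rewrite prob_codes //.
have d0 : (#|codes N|%:R != 0 :> R)%R by rewrite pnatr_eq0 -lt0n codes_gt0.
apply: (mulIf d0); rewrite mulrBl !divfK // mul1r; apply/eqP; rewrite subr_eq -natrD.
apply/eqP; congr (_%:R)%R; rewrite -cardsUI.
set S1 := (X in (X :|: _)%SET); set S2 := (X in (_ :|: X)%SET).
have -> : (S1 :&: S2)%SET = finset.set0.
  by apply/setP => c; rewrite !inE; case: (is_code c) => //=; case: asboolP.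
rewrite cards0 addn0; apply: eq_card => c; rewrite !inE.
by case: (is_code c) => //=; case: asboolP.
Qed.

Lemma ball_iso_invariant r (K G H : mgraph) : mgraph_iso G H ->
  mgraph_iso (ball_graph r G) K -> mgraph_iso (ball_graph r H) K.
Proof. by move=> GH; apply/mgraph_iso_trans/mgraph_iso_sym/ball_graph_iso. Qed.

End Limit.

Local Open Scope classical_set_scope.

Theorem theorem1p6 (R : realType) :
  [/\ infinite_set [set: vert hatN],
      local_weak_cvg R hatN &
      forall r : nat,
        (fun n => prob_net R n
           (fun N => mgraph_iso (ball_graph r N) (ball_graph r hatN)))
          @ \oo --> (1 : R)%R].
Proof.
split.
- pose g (v : vert hatN) := if v is HDec (RootSpine t) then t else 0.
  move=> /(finite_image g) fin; apply: infinite_nat; apply: sub_finite_set fin.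
  by move=> t _; exists (HDec (RootSpine t)).
- move=> r G _; case: (asboolP (mgraph_iso _ _)) => hG.
    apply: prob_cvg1; first exact: ball_iso_invariant.
    apply: (negl_sub (negl_ball r)) => N c _; apply: contra => /asboolP h.
    exact/asboolP/(mgraph_iso_trans h).
  apply: prob_cvg0; first exact: ball_iso_invariant.
  apply: (negl_sub (negl_ball r)) => N c _ /asboolP h; apply/asboolPn => h'.
  exact/hG/(mgraph_iso_trans (mgraph_iso_sym h')).
by move=> r; apply: prob_cvg1; [exact: ball_iso_invariant|exact: negl_ball].
Qed.
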